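(* There is a universal constant $C>0$ such that the following holds. Let $(\xi_{ij})_{i,j\ge 1}$ be i.i.d. real random variables, distributed as a random variable $\xi$ with $\mathbf{E}[\xi]=0$, $\mathbf{E}[\xi^2]=1$ and $\mathbf{E}[|\xi|^3]<+\infty$. Then, as $N\to\infty$, $$N^{-3/2}S_N(\xi)\to e_\infty\quad\text{almost surely and in average (i.e. } N^{-3/2}\mathbf{E}[S_N(\xi)]\to e_\infty\text{)}.$$ Furthermore, for every $N\ge 1$, $$N^{-3/2}\,\big|\mathbf{E}[S_N(\xi)]-\mathbf{E}[S_N(g)]\big|\le C\,\big(1+\mathbf{E}[|\xi|^3]\big)\,N^{-1/6}.$$
   Context: For $N\ge1$ and a real array $\xi=(\xi_{ij})$, set $S_N(\xi)=\sup_{\sigma\in\{-1,1\}^N}\sum_{1\le i,j\le N}\sigma_i\sigma_j\xi_{ij}$. $\mathbf{E}$ denotes expectation with respect to the environment. $g=(g_{ij})_{i,j\ge1}$ denotes an environment of i.i.d. standard Gaussian $\mathcal N(0,1)$ variables. The number $e_\infty$ is the deterministic limit of $N^{-3/2}S_N(g)$, almost surely and in average, as $N\to\infty$; the existence of this limit for the Gaussian environment is a known theorem of Guerra and Toninelli. *)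

(* Defs.v *)
From HB Require Import structures.
From mathcomp Require Import all_boot all_order all_algebra finmap.
From mathcomp Require Import all_classical all_reals all_analysis.

Set Implicit Arguments.
Unset Strict Implicit.
Unset Printing Implicit Defensive.

Import Order.TTheory GRing.Theory Num.Theory.
Import numFieldNormedType.Exports.

Local Open Scope classical_set_scope.
Local Open Scope ring_scope.

Section Environments.
Context {R : realType}.

Definition spins {N : nat} : set ('I_N -> R) :=
  [set s | forall i, s i = -1 \/ s i = 1].

(* Environments are indexed from 0, so only the entries with i, j < N are used;
   the supremum is over a finite nonempty set of reals. *)
Definition Smax (N : nat) (x : nat -> nat -> R) : R :=
  sup [set \sum_(i < N) \sum_(j < N) s i * s j * x i j | s in spins].

Context {d : measure_display} {T : measurableType d} (P : probability T R).

Definition mutually_independent (I : choiceType) (X : I -> {RV P >-> R}) :=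
  forall (J : {fset I}) (B : I -> set R), (forall i, measurable (B i)) ->
  P (\bigcap_(i in [set` J]) (X i @^-1` B i)) =
  (\prod_(i <- J) P (X i @^-1` B i))%E.

(* Laws are compared on measurable sets only, a measure having no
   prescribed values elsewhere. *)
Definition iid_array (x : nat -> nat -> {RV P >-> R})
    (mu : set R -> \bar R) :=
  mutually_independent (fun ij : nat * nat => x ij.1 ij.2) /\
  forall i j (B : set R), measurable B -> distribution P (x i j) B = mu B.

Definition gaussian_array (g : nat -> nat -> {RV P >-> R}) :=
  iid_array g (normal_prob 0 1).

Definition Smax_rv (N : nat) (x : nat -> nat -> {RV P >-> R}) : T -> R :=
  fun w => Smax N (fun i j => x i j w).

Definition ground_state_limit (x : nat -> nat -> {RV P >-> R}) (e : R) :=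
  {ae P, forall w,
    (fun N : nat => N%:R `^ (- (3 / 2)) * Smax_rv N x w) @ \oo --> e} /\
  (fun N : nat => ((N%:R `^ (- (3 / 2)))%:E * 'E_P[Smax_rv N x])%E) @ \oo --> e%:E.

End Environments.

(* Main.v *)
Require Import Defs.
From HB Require Import structures.
From mathcomp Require Import all_boot all_order all_algebra finmap.
From mathcomp Require Import all_classical all_reals all_analysis measurable_realfun.
From mathcomp Require Import ring lra.

(** Lindeberg's replacement argument, run on a smooth version of the maximum.
At inverse temperature b, the soft maximum b^-1 ln (sum_s exp (b H_s)) is within
b^-1 N ln 2 of the ground state S_N.  As a function of one entry y it has the form
b^-1 ln (A exp (b y) + B exp (- b y)), whose third-order Taylor remainder is at most
2 b^2 |y|^3 whatever A and B are.  Trading the N^2 entries of xi for Gaussian ones,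
one at a time and with two matching moments, therefore costs
O (N^2 b^2 (1 + E|xi|^3)), and b = N^(-1/3) balances the two errors.

For the almost sure convergence, resampling the entries one at a time along an
independent copy gives Var (S_N) <= 2 N^2, so that S_N / N^(3/2) converges along
N = k^4; since S_N + sum_(i < N) |xi_ii| is nondecreasing in N, the values in between
are sandwiched. *)

Set Implicit Arguments.
Unset Strict Implicit.
Unset Printing Implicit Defensive.

Import Order.TTheory GRing.Theory Num.Theory.
Import numFieldNormedType.Exports.

Local Open Scope classical_set_scope.
Local Open Scope ring_scope.

(** The two environments live on unrelated probability spaces, and only their means are compared;
    they are therefore put side by side on the product space, as one independent family indexed by a
    sum type. Joining [xi] with itself in the same way supplies the independent copy for the
    variance bound.

    Independence is given for finite boxes of events, whereas a replacement step needs an entry to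
    be independent of a function of all the others. A pi-lambda argument for the sigma-algebras
    generated by disjoint sets of entries bridges the two.

    The exponent 4 of the subsequence comes from the diagonal correction rather than from the
    variance. After normalisation the variance is at most 2 / N, but the mean of the diagonal sum is
    only of order N^(-1/2), which along N = k^p is summable for p > 2 only. With p = 4 it is of
    order k^(-2), and N^(3/2) = k^6 is an integer power. *)

Lemma sqr_le_1Dcube (R : realFieldType) (a : R) : 0 <= a -> a ^+ 2 <= 1 + a ^+ 3.
Proof.
move=> a0; have [a1|a1] := leP a 1.
  by rewrite ler_wpDr ?exprn_ge0// exprn_ile1.
by rewrite ler_wpDl// ler_eXn2l // ltW.
Qed.

Lemma normrM_le_sqrD (R : realFieldType) (a b : R) : `|a * b| <= a ^+ 2 + b ^+ 2.
Proof.
rewrite ler_norml; have := sqr_ge0 (a - b); have := sqr_ge0 (a + b).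
by move=> h1 h2; apply/andP; split; nra.
Qed.

Lemma normr_le_1Dsqr (R : realFieldType) (a : R) : `|a| <= 1 + a ^+ 2.
Proof. by have := normrM_le_sqrD 1 a; rewrite mul1r expr1n. Qed.

(** * Real-valued expectations *)

Section real_expectation.
Context {d} {T : measurableType d} {R : realType} (P : probability T R).
Implicit Types f g : T -> R.

Definition rint f := P.-integrable setT (EFin \o f).

Lemma rint_measurable f : rint f -> measurable_fun setT f.
Proof. by move=> /measurable_int/measurable_EFinP. Qed.

Lemma rint_cst r : rint (fun=> r).
Proof. exact: finite_measure_integrable_cst. Qed.

Lemma rintD f g : rint f -> rint g -> rint (fun w => f w + g w).
Proof. by move=> fi gi; apply: eq_integrable (integrableD _ fi gi). Qed.

Lemma rintB f g : rint f -> rint g -> rint (fun w => f w - g w).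
Proof. by move=> fi gi; apply: eq_integrable (integrableB _ fi gi). Qed.

Lemma rintZ r f : rint f -> rint (fun w => r * f w).
Proof. by move=> fi; apply: eq_integrable (integrableZl _ r fi). Qed.

Lemma rint_norm f : rint f -> rint (fun w => `|f w|).
Proof. by move=> fi; apply: integrable_norm. Qed.

Lemma rint_le f g : measurable_fun setT f -> (forall w, `|f w| <= `|g w|) ->
  rint g -> rint f.
Proof.
move=> mf fg; apply: le_integrable => //; first exact/measurable_EFinP.
by move=> x _; rewrite lee_fin.
Qed.

Lemma rint_sum (I : Type) (s : seq I) (F : I -> T -> R) :
  (forall i, rint (F i)) -> rint (fun w => \sum_(i <- s) F i w).
Proof.
move=> Fi; elim: s => [|i s IH].
  by under [X in rint X]eq_fun do rewrite big_nil; exact: rint_cst.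
by under [X in rint X]eq_fun do rewrite big_cons; exact: rintD.
Qed.

Lemma rint_bounded M f : measurable_fun setT f -> (forall w, `|f w| <= M) ->
  rint f.
Proof.
move=> mf fM; apply: (@rint_le _ (fun=> M)) => // [w|]; last exact: rint_cst.
exact: le_trans (fM w) (ler_norm _).
Qed.

Lemma rint_mul2 f g : measurable_fun setT f -> measurable_fun setT g ->
  rint (fun w => f w ^+ 2) -> rint (fun w => g w ^+ 2) ->
  rint (fun w => f w * g w).
Proof.
move=> mf mg f2 g2.
apply: (@rint_le _ (fun w => f w ^+ 2 + g w ^+ 2)).
- exact: measurable_funM.
- by move=> w; exact: le_trans (normrM_le_sqrD _ _) (ler_norm _).
- exact: rintD.
Qed.

Lemma rint_sqrD f g : measurable_fun setT f -> measurable_fun setT g ->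
  rint (fun w => f w ^+ 2) -> rint (fun w => g w ^+ 2) ->
  rint (fun w => (f w + g w) ^+ 2).
Proof.
move=> mf mg f2 g2.
under [X in rint X]eq_fun do rewrite sqrrD -mulr_natl.
by apply: rintD => //; apply: rintD => //; apply: rintZ; exact: rint_mul2.
Qed.

Lemma rint_sqr_of_cube f : measurable_fun setT f -> rint (fun w => `|f w| ^+ 3) ->
  rint (fun w => f w ^+ 2).
Proof.
move=> mf f3; apply: (@rint_le _ (fun w => 1 + `|f w| ^+ 3)).
- exact: measurable_funX.
- move=> w; rewrite normrX.
  exact: le_trans (sqr_le_1Dcube (normr_ge0 _)) (ler_norm _).
- by apply: rintD => //; exact: rint_cst.
Qed.

Lemma rint_of_sqr f : measurable_fun setT f -> rint (fun w => f w ^+ 2) ->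
  rint f.
Proof.
move=> mf f2; apply: (@rint_le _ (fun w => 1 + f w ^+ 2)) => //.
- by move=> w; exact: le_trans (normr_le_1Dsqr _) (ler_norm _).
- by apply: rintD => //; exact: rint_cst.
Qed.

(** Bridge to the extended expectations of the statement. Everything else is done with real
    integrals, where [ring], [lra] and [nra] apply. *)
Lemma rintE f : rint f -> ('E_P[f] = (\int[P]_w f w)%R%:E)%E.
Proof.
move=> fi; rewrite unlock /Rintegral fineK//.
exact: integrable_fin_num.
Qed.

Lemma ExD f g : rint f -> rint g ->
  \int[P]_w (f w + g w) = \int[P]_w f w + \int[P]_w g w.
Proof. by move=> *; rewrite RintegralD. Qed.

Lemma ExB f g : rint f -> rint g ->
  \int[P]_w (f w - g w) = \int[P]_w f w - \int[P]_w g w.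
Proof. by move=> *; rewrite RintegralB. Qed.

Lemma ExZ r f : rint f -> \int[P]_w (r * f w) = r * \int[P]_w f w.
Proof. by move=> *; rewrite RintegralZl. Qed.

Lemma Ex_cst r : \int[P]_w r = r.
Proof.
rewrite Rintegral_cst//= (_ : P _ = 1%E) ?mulr1//.
exact: probability_setT.
Qed.

Lemma le_Ex f g : rint f -> rint g -> (forall w, f w <= g w) ->
  \int[P]_w f w <= \int[P]_w g w.
Proof. by move=> *; apply: le_Rintegral. Qed.

Lemma normr_Ex f : rint f -> `|\int[P]_w f w| <= \int[P]_w `|f w|.
Proof. by move=> *; apply: le_normr_Rintegral. Qed.

Lemma eq_Ex f g : f =1 g -> \int[P]_w f w = \int[P]_w g w.
Proof. by move=> fg; apply: eq_Rintegral => x _. Qed.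

Lemma Ex_sum (I : Type) (s : seq I) (F : I -> T -> R) :
  (forall i, rint (F i)) ->
  \int[P]_w (\sum_(i <- s) F i w) = \sum_(i <- s) \int[P]_w F i w.
Proof.
move=> Fi; elim: s => [|i s IH].
  by rewrite big_nil -[RHS]Ex_cst; apply: eq_Ex => w; rewrite big_nil.
rewrite big_cons -IH -ExD//; last exact: rint_sum.
by apply: eq_Ex => w; rewrite big_cons.
Qed.

End real_expectation.

(** * Change of variables along a law *)

Section transfer.
Context d d' {T : measurableType d} {T' : measurableType d'} {R : realType}
  (P : probability T R) (P' : probability T' R) (U : T -> T').
Hypotheses (mU : measurable_fun setT U)
  (lawU : forall A, measurable A -> P (U @^-1` A) = P' A).

Let V : {mfun T >-> T'} := mfun_Sub (mem_set mU).

(** [P'] is known to be the law of [U] on measurable sets only, which is all that an integral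
    sees. *)
Let eqI (f : T' -> \bar R) :
  (\int[P']_y f y = \int[distribution P V]_y f y)%E.
Proof. by apply: eq_measure_integral => A mA _; rewrite /distribution/= -lawU. Qed.

Lemma rint_law (f : T' -> R) : measurable_fun setT f ->
  rint P' f <-> rint P (f \o U).
Proof.
move=> mf; split=> /integrableP[_ fi]; apply/integrableP; split.
- by apply/measurable_EFinP; exact: measurableT_comp.
- move: fi; rewrite eqI ge0_integral_distribution//.
  by do 2 apply: measurableT_comp => //.
- exact/measurable_EFinP.
- rewrite eqI ge0_integral_distribution//.
  by do 2 apply: measurableT_comp => //.
Qed.

Lemma Ex_law (f : T' -> R) : measurable_fun setT f -> rint P' f ->
  \int[P']_y f y = \int[P]_w f (U w).
Proof.
move=> mf fi; rewrite /Rintegral eqI integral_distribution//.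
  exact/measurable_EFinP.
exact/rint_law.
Qed.

End transfer.

Section product_expectation.
Context d d' {T : measurableType d} {T' : measurableType d'} {R : realType}
  (P : probability T R) (P' : probability T' R).
Variables (f : T -> R) (g : T' -> R).
Hypotheses (fi : rint P f) (gi : rint P' g).

Let mfg : measurable_fun setT (fun z : T * T' => f z.1 * g z.2).
Proof.
have mf := rint_measurable fi; have mg := rint_measurable gi.
by apply: measurable_funM; exact: measurableT_comp.
Qed.

Lemma rint_prod : rint (P \x P')%E (fun z : T * T' => f z.1 * g z.2).
Proof.
apply/integrable12ltyP; first exact/measurable_EFinP.
have h x : (\int[P']_y `|(f x * g y)%R%:E| =
   (`|f x| * \int[P']_y `|g y|)%R%:E)%E.
  rewrite EFinM /Rintegral fineK; last first.
    by apply: integrable_fin_num => //; exact: rint_norm.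
  rewrite -integralZl//; last exact: rint_norm.
  by apply: eq_integral => y _; rewrite /= normrM EFinM.
rewrite (eq_integral (fun x => (`|f x| * \int[P']_y `|g y|)%R%:E)); last first.
  by move=> x _; exact: h.
have hi := rintZ (\int[P']_y `|g y|) (rint_norm fi).
have mh := rint_measurable hi.
have mh' : measurable_fun setT (fun x => `|f x| * \int[P']_y `|g y|).
  by under eq_fun do rewrite mulrC.
case/integrableP : hi => _; apply: le_lt_trans; apply: ge0_le_integral => //.
- by move=> x _; rewrite lee_fin mulr_ge0//; exact: Rintegral_ge0.
- exact/measurable_EFinP.
- by apply/measurableT_comp => //; exact/measurable_EFinP.
- by move=> x _; rewrite lee_fin mulrC ler_norm.
Qed.

Lemma Ex_prod :
  \int[(P \x P')%E]_z (f z.1 * g z.2) = (\int[P]_x f x) * (\int[P']_y g y).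
Proof.
rewrite {1}/Rintegral -(integral12_prod_meas1 rint_prod) /fubini_F/=.
have h x : (\int[P']_y (f x * g y)%R%:E = (f x * \int[P']_y g y)%R%:E)%E.
  rewrite EFinM /Rintegral fineK; last by apply: integrable_fin_num.
  by rewrite -integralZl//; apply: eq_integral => y _; rewrite EFinM.
under eq_integral do rewrite h.
by rewrite -[LHS]/(\int[P]_x (f x * _)) RintegralZr.
Qed.

End product_expectation.

(** * Independence *)

Section joint_law.
Context d d1 d2 {T : measurableType d} {T1 : measurableType d1}
  {T2 : measurableType d2} {R : realType} (P : probability T R)
  (P1 : probability T1 R) (P2 : probability T2 R) (U : T -> T1) (V : T -> T2).
Hypotheses (mU : measurable_fun setT U) (mV : measurable_fun setT V)
  (lawUV : forall A B, measurable A -> measurable B ->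
     P (U @^-1` A `&` V @^-1` B) = (P1 A * P2 B)%E).

Lemma measurable_pair : measurable_fun setT (fun w => (U w, V w)).
Proof. exact/measurable_fun_pair. Qed.

(** Rectangles determine a measure on the product; independence thus becomes a product law, to which
    Fubini's theorem applies. *)
Lemma joint_law C : measurable C ->
  P ((fun w => (U w, V w)) @^-1` C) = (P1 \x P2)%E C.
Proof.
move=> mC; pose W : {mfun T >-> (T1 * T2)%type} := mfun_Sub (mem_set measurable_pair).
rewrite (@product_measure_unique _ _ _ _ _ P1 P2 (distribution P W))//.
Qed.

End joint_law.

Section independence.
Context {d} {T : measurableType d} {R : realType} (P : probability T R)
  {I : choiceType} (X : I -> {RV P >-> R}).
Implicit Types (J : set I) (B : I -> set R) (s : seq I).

Definition box B : set T := [set w | forall i, B i (X i w)].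

Definition box_on J s B :=
  [/\ forall i, measurable (B i), forall i, i \notin s -> B i = setT
    & forall i, ~ J i -> B i = setT].

(** Events that constrain finitely many coordinates, all of them in [J]: a pi-system generating the
    sigma-algebra of the [X i] with [i] in [J]. *)
Definition cylinder J : set (set T) :=
  [set A | exists s B, box_on J s B /\ A = box B].

Lemma boxE s B : (forall i, i \notin s -> B i = setT) ->
  box B = \bigcap_(i in [set` s]) (X i @^-1` B i).
Proof.
move=> Bs; apply/seteqP; split=> [w Bw i _|w Bw i]; first exact: Bw.
have [si|si] := boolP (i \in s); first exact: Bw.
by rewrite Bs.
Qed.

Lemma measurable_cylinder J : cylinder J `<=` measurable.
Proof.
move=> _ [s [B [[mB Bs _] ->]]]; rewrite (boxE Bs) bigcap_seq.
by apply: bigsetI_measurable => i _; apply: measurable_funPTI.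
Qed.

Lemma cylinder_setI J : setI_closed (cylinder J).
Proof.
move=> _ _ [s [B [[mB Bs BJ] ->]]] [s' [B' [[mB' Bs' BJ'] ->]]].
exists (s ++ s'), (fun i => B i `&` B' i); split.
  split=> i; first exact: measurableI.
    by rewrite mem_cat negb_or => /andP[/Bs-> /Bs'->]; rewrite setIT.
  by move=> Ji; rewrite BJ ?BJ' ?setIT.
apply/seteqP; split=> [w [Bw B'w] i|w Bw]; first by split.
by split=> i; have [] := Bw i.
Qed.

Lemma cylinder_setT J : cylinder J setT.
Proof. by exists [::], (fun=> setT); split=> //; apply/seteqP; split. Qed.

Hypothesis indX : mutually_independent X.

Lemma probability_box (s : seq I) B : uniq s -> (forall i, measurable (B i)) ->
  (forall i, i \notin s -> B i = setT) ->
  P (box B) = (\prod_(i <- s) P (X i @^-1` B i))%E.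
Proof.
move=> us mB Bs; have := indX [fset i in s]%fset mB.
have -> : [set` [fset i in s]%fset] = [set` s].
  by apply/seteqP; split=> i /=; rewrite inE.
rewrite -(boxE Bs) => ->; apply: perm_big.
by apply: uniq_perm => // i; rewrite inE.
Qed.

(** Both boxes are written over the common list [u]. Since [J] and [J'] are disjoint, each
    coordinate is constrained by at most one of them, and the product formula splits factor by
    factor. *)
Lemma indep_cylinder J J' A A' : (forall i, J i -> ~ J' i) ->
  cylinder J A -> cylinder J' A' -> P (A `&` A') = (P A * P A')%E.
Proof.
move=> JJ' [s [B [[mB Bs BJ] ->]]] [s' [B' [[mB' Bs' BJ'] ->]]].
pose u := undup (s ++ s').
have uu : uniq u by exact: undup_uniq.
have Bu i : i \notin u -> B i = setT.
  by rewrite mem_undup mem_cat negb_or => /andP[/Bs].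
have Bu' i : i \notin u -> B' i = setT.
  by rewrite mem_undup mem_cat negb_or => /andP[_ /Bs'].
have -> : box B `&` box B' = box (fun i => B i `&` B' i).
  apply/seteqP; split=> [w [Bw B'w] i|w Bw]; first by split.
  by split=> i; have [] := Bw i.
rewrite !(@probability_box u)//.
- rewrite -big_split; apply: eq_bigr => i _ /=.
  have [Ji|Ji] := pselect (J i).
    by rewrite (BJ' i (JJ' i Ji)) setIT preimage_setT probability_setT mule1.
  by rewrite (BJ i Ji) setTI preimage_setT probability_setT mul1e.
- by move=> i; exact: measurableI.
- by move=> i iu; rewrite Bu// Bu'// setIT.
Qed.

(** With [A'] fixed, [A |-> P (A & A')] and [A |-> P A' * P A] are finite measures that agree on the
    pi-system [G], hence on the sigma-algebra it generates. *)
Let half_indep (G : set (set T)) A' : G `<=` measurable -> setI_closed G ->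
  G setT -> measurable A' ->
  (forall A, G A -> P (A `&` A') = (P A * P A')%E) ->
  forall A, <<s G >> A -> P (A `&` A') = (P A * P A')%E.
Proof.
move=> Gm GI GT mA' h A sA.
have p0 : 0 <= fine (P A') by apply: fine_ge0; exact: measure_ge0.
have pE : P A' = (fine (P A'))%:E by rewrite fineK// fin_num_measure.
rewrite muleC pE.
apply: (@g_sigma_algebra_measure_unique _ R T G Gm (fun=> setT) (fun=> GT) _
  (mrestr P mA') (mscale (NngNum p0) P) GI _ _ A sA).
- by apply/seteqP; split=> // x _; exists 0%N.
- by move=> A0 GA0; rewrite -[LHS]/(P (A0 `&` A')) h// muleC {1}pE.
- move=> _; rewrite -[X in (X < _)%E]/(P (setT `&` A')).
  by rewrite setTI -ge0_fin_numE// fin_num_measure.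
Qed.

(** The points are those of [T] but the sigma-algebra is coarser: depending only on the coordinates
    in [J] becomes ordinary measurability on another measurable type, so the usual closure lemmas
    apply as they are. *)
Definition cyl_sigma J := g_sigma_algebraType (cylinder J).

Definition meas_on J d' (T' : measurableType d') (f : T -> T') :=
  measurable_fun setT (f : cyl_sigma J -> T').

Lemma cyl_sigma_sub J : <<s cylinder J>> `<=` @measurable _ T.
Proof.
exact: smallest_sub (@sigma_algebra_measurable _ T) (@measurable_cylinder J).
Qed.

(** [half_indep] is used once for each factor: cylinders are first enlarged to the sigma-algebra on
    one side, then on the other. *)
Lemma indep_sigma J J' A A' : (forall i, J i -> ~ J' i) ->
  <<s cylinder J>> A -> <<s cylinder J'>> A' -> P (A `&` A') = (P A * P A')%E.
Proof.
move=> JJ' sA sA'; have mA' := cyl_sigma_sub sA'.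
apply: (half_indep _ _ _ mA' _ sA) => [|||{sA}A cA].
- exact: measurable_cylinder.
- exact: cylinder_setI.
- exact: cylinder_setT.
rewrite setIC muleC; apply: (half_indep _ _ _ _ _ sA') => [||||B cB].
- exact: measurable_cylinder.
- exact: cylinder_setI.
- exact: cylinder_setT.
- exact: measurable_cylinder cA.
by rewrite setIC muleC; exact: (indep_cylinder JJ' cA cB).
Qed.

Lemma meas_on_measurable J d' (T' : measurableType d') (f : T -> T') :
  meas_on J f -> measurable_fun setT f.
Proof.
move=> mf _ B mB; rewrite setTI; apply: (@cyl_sigma_sub J).
by have := mf measurableT B mB; rewrite setTI.
Qed.

Lemma meas_on_coord J i : J i -> meas_on J (X i).
Proof.
move=> Ji _ B mB; rewrite setTI; apply: sub_sigma_algebra.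
exists [:: i], (fun j => if j == i then B else setT); split.
  split=> j; first by case: ifP.
    by rewrite inE => /negbTE->.
  by case: eqP => // ->.
apply/seteqP; split=> [w Bw j|w Bw]; first by case: eqP => [->|].
by have := Bw i; rewrite eqxx.
Qed.

Lemma indep_preimage J J' d1 (T1 : measurableType d1) d2 (T2 : measurableType d2)
    (f : T -> T1) (g : T -> T2) A A2 :
  (forall i, J i -> ~ J' i) -> meas_on J f -> meas_on J' g ->
  measurable A -> measurable A2 ->
  P (f @^-1` A `&` g @^-1` A2) = (P (f @^-1` A) * P (g @^-1` A2))%E.
Proof.
move=> JJ' mf mg mA mA2; apply: (indep_sigma JJ').
- by have := mf measurableT A mA; rewrite setTI.
- by have := mg measurableT A2 mA2; rewrite setTI.
Qed.

Lemma Ex_indep J J' (f g : T -> R) :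
  (forall i, J i -> ~ J' i) -> meas_on J f -> meas_on J' g ->
  rint P f -> rint P g ->
  rint P (fun w => f w * g w) /\
  \int[P]_w (f w * g w) = (\int[P]_w f w) * \int[P]_w g w.
Proof.
move=> JJ' mf mg fi gi.
have mf' := meas_on_measurable mf; have mg' := meas_on_measurable mg.
pose F : {RV P >-> R} := mfun_Sub (mem_set mf').
pose G : {RV P >-> R} := mfun_Sub (mem_set mg').
have law := @joint_law _ _ _ _ _ _ _ P (distribution P F) (distribution P G)
  f g mf' mg' (fun A A2 mA mA2 => indep_preimage JJ' mf mg mA mA2).
have mid : measurable_fun setT (@id R) by [].
have Fi : rint (distribution P F) id by apply/(rint_law mf').
have Gi : rint (distribution P G) id by apply/(rint_law mg').
have mfg := measurable_pair mf' mg'.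
have mm : measurable_fun setT (fun z : R * R => z.1 * z.2).
  by apply: measurable_funM.
have ii := rint_prod Fi Gi.
split; first exact/(rint_law mfg law mm).
have := Ex_law mfg law mm ii; rewrite (Ex_prod Fi Gi) => <-.
by rewrite -(Ex_law mf' _ mid Fi)// -(Ex_law mg' _ mid Gi).
Qed.

(** The identity, seen as a random element of [cyl_sigma J], is independent of [V] and of [V']. The
    pairs [(w, V w)] and [(w, V' w)] then have the same product law, so a variable can be exchanged
    for an equidistributed one inside an arbitrary function of the remaining coordinates. *)
Lemma Ex_swap J J1 J2 (V V' : T -> R) (h : cyl_sigma J * R -> R) :
  (forall i, J i -> ~ J1 i) -> (forall i, J i -> ~ J2 i) ->
  meas_on J1 V -> meas_on J2 V' ->
  (forall A, measurable A -> P (V @^-1` A) = P (V' @^-1` A)) ->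
  measurable_fun setT h ->
  rint P (fun w => h (w, V w)) ->
  \int[P]_w h (w, V w) = \int[P]_w h (w, V' w).
Proof.
move=> JJ1 JJ2 mV mV' VV' mh hi.
have mV1 := meas_on_measurable mV; have mV'1 := meas_on_measurable mV'.
pose VV : {RV P >-> R} := mfun_Sub (mem_set mV1).
have mid : measurable_fun setT (id : T -> cyl_sigma J).
  by move=> _ A mA; rewrite setTI; exact: cyl_sigma_sub mA.
pose id' : {RV P >-> cyl_sigma J} := mfun_Sub (mem_set mid).
have idJ : meas_on J (id : T -> cyl_sigma J) by move=> _ A mA; rewrite setTI.
pose Q := distribution P id'; pose Q' := distribution P VV.
have law A (A2 : set R) : measurable A -> measurable A2 ->
    P ((id : T -> cyl_sigma J) @^-1` A `&` V @^-1` A2) = (Q A * Q' A2)%E.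
  by move=> mA mB; rewrite (indep_preimage JJ1 idJ mV).
have law' A (A2 : set R) : measurable A -> measurable A2 ->
    P ((id : T -> cyl_sigma J) @^-1` A `&` V' @^-1` A2) = (Q A * Q' A2)%E.
  move=> mA mB; rewrite (indep_preimage JJ2 idJ mV')//.
  by rewrite -VV'.
have l := joint_law mid mV1 law; have l' := joint_law mid mV'1 law'.
have hi' : rint (Q \x Q')%E h.
  exact/(rint_law (measurable_pair mid mV1) l mh).
by rewrite -(Ex_law (measurable_pair mid mV1) l mh hi')
  -(Ex_law (measurable_pair mid mV'1) l' mh hi').
Qed.

End independence.

(** * Two independent families on a product space *)

Section product_family.
Context {d d'} {T : measurableType d} {T' : measurableType d'} {R : realType}
  (P : probability T R) (Q : probability T' R) {I : choiceType}
  (x : I -> {RV P >-> R}) (y : I -> {RV Q >-> R}).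

Definition join_fun (u : I + I) (w : T * T') : R :=
  match u with inl i => x i w.1 | inr i => y i w.2 end.

Lemma measurable_join_fun u : measurable_fun setT (join_fun u).
Proof.
case: u => i /=; first exact: (measurableT_comp (measurable_funPT (x i))).
exact: (measurableT_comp (measurable_funPT (y i))).
Qed.

Definition join_rv (u : I + I) : {RV (P \x Q)%E >-> R} :=
  mfun_Sub (mem_set (measurable_join_fun u)).

Lemma law_join_inl i (B : set R) : measurable B ->
  (P \x Q)%E (join_rv (inl i) @^-1` B) = P (x i @^-1` B).
Proof.
move=> mB; have -> : join_rv (inl i) @^-1` B = (x i @^-1` B) `*` setT.
  by apply/seteqP; split => -[w w'] //= [].
rewrite product_measure1E//; last exact: measurable_funPTI.
by rewrite [X in (_ * X)%E](_ : _ = 1%E) ?mule1//; exact: probability_setT.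
Qed.

Lemma law_join_inr i (B : set R) : measurable B ->
  (P \x Q)%E (join_rv (inr i) @^-1` B) = Q (y i @^-1` B).
Proof.
move=> mB; have -> : join_rv (inr i) @^-1` B = setT `*` (y i @^-1` B).
  by apply/seteqP; split => -[w w'] //= [].
rewrite product_measure1E//; last exact: measurable_funPTI.
by rewrite [X in (X * _)%E](_ : _ = 1%E) ?mul1e//; exact: probability_setT.
Qed.

Hypotheses (indx : mutually_independent x) (indy : mutually_independent y).

Lemma indep_join : mutually_independent join_rv.
Proof.
move=> J B mB.
(* [fl] and [fr] are the partial inverses of [inl] and [inr]; they cut the finite index set [J] into
   its two sides. *)
pose fl (u : I + I) := if u is inl i then Some i else None.
pose fr (u : I + I) := if u is inr i then Some i else None.
pose s1 := pmap fl (enum_fset J); pose s2 := pmap fr (enum_fset J).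
have us1 : uniq s1.
  by apply: (@pmap_uniq _ _ fl inl) => [[]|] //; exact: fset_uniq.
have us2 : uniq s2.
  by apply: (@pmap_uniq _ _ fr inr) => [[]|] //; exact: fset_uniq.
have s1E i : (i \in s1) = (inl i \in J).
  rewrite mem_pmap; apply/mapP/idP => [[[j|j] Jj] //= [->] //|Ji].
  by exists (inl i).
have s2E i : (i \in s2) = (inr i \in J).
  rewrite mem_pmap; apply/mapP/idP => [[[j|j] Jj] //= [->] //|Ji].
  by exists (inr i).
have pJ : perm_eq (enum_fset J) (map inl s1 ++ map inr s2).
  apply: uniq_perm; first exact: fset_uniq.
    rewrite cat_uniq !map_inj_uniq ?us1 ?us2 ?andbT; last 2 first.
    - by move=> ? ? [].
    - by move=> ? ? [].
    by apply/hasPn => _ /mapP[i _ ->]; apply/negP => /mapP[].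
  move=> [] i; rewrite mem_cat.
    rewrite mem_map ?s1E; last by move=> ? ? [].
    by rewrite [X in _ || X](_ : _ = false) ?orbF//; apply/negP => /mapP[].
  rewrite mem_map ?s2E; last by move=> ? ? [].
  by rewrite [X in X || _](_ : _ = false)//; apply/negP => /mapP[].
(* A [box] constrains every index, so the sets coming from indices outside [J] have to be reset to
   [setT]. *)
pose B1 i := if i \in s1 then B (inl i) else setT.
pose B2 i := if i \in s2 then B (inr i) else setT.
have mB1 i : measurable (B1 i) by rewrite /B1; case: ifP.
have mB2 i : measurable (B2 i) by rewrite /B2; case: ifP.
have B1s i : i \notin s1 -> B1 i = setT by rewrite /B1 => /negbTE->.
have B2s i : i \notin s2 -> B2 i = setT by rewrite /B2 => /negbTE->.
have mbox1 : measurable (box x B1).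
  by apply: (@measurable_cylinder _ _ _ _ _ x setT); exists s1, B1; split=> //; split=> // i; case.
have mbox2 : measurable (box y B2).
  by apply: (@measurable_cylinder _ _ _ _ _ y setT); exists s2, B2; split=> //; split=> // i; case.
have -> : \bigcap_(i in [set` J]) (join_rv i @^-1` B i) = box x B1 `*` box y B2.
  apply/seteqP; split=> [[w w'] Jw|[w w'] [/= w1 w2] [] i /= Ji].
  - split=> i /=; rewrite /B1 /B2; case: ifP => //.
      by rewrite s1E => Ji; have := Jw _ Ji.
    by rewrite s2E => Ji; have := Jw _ Ji.
  - by have := w1 i; rewrite /B1 s1E Ji.
  - by have := w2 i; rewrite /B2 s2E Ji.
transitivity (P (box x B1) * Q (box y B2))%E.
  exact: (product_measure1E P Q mbox1 mbox2).
rewrite (probability_box indx us1)// (probability_box indy us2)//.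
rewrite (perm_big _ pJ)/= big_cat !big_map /=; congr (_ * _)%E.
  by apply: eq_big_seq => i si; rewrite law_join_inl// /B1 si.
by apply: eq_big_seq => i si; rewrite law_join_inr// /B2 si.
Qed.

End product_family.

(** * Third-order Taylor bound *)

(** Mean value theorem on either side of 0. Three successive uses, for [T], for [T] minus its linear
    part and for the logarithm, replace Taylor's formula with remainder. *)
Lemma le_of_derive_bound (R : realType) (h dh : R -> R) (M y : R) :
  (forall z : R, is_derive z 1 h (dh z)) ->
  (forall z, `|z| <= `|y| -> `|dh z| <= M) -> `|h y - h 0| <= M * `|y|.
Proof.
move=> hd hM.
have ch a b : {within `[a, b], continuous h}.
  apply: derivable_within_continuous => z _.
  exact: ex_derive.
have [y0|y0] := leP 0 y.
  have [c] := MVT_segment y0 (fun z _ => hd z) (@ch 0 y).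
  rewrite in_itv/= subr0 => /andP[c0 cy] ->.
  by rewrite normrM ler_wpM2r// hM// !ger0_norm.
have [c] := MVT_segment (ltW y0) (fun z _ => hd z) (@ch y 0).
rewrite in_itv/= sub0r distrC => /andP[yc c0] ->.
by rewrite normrM normrN ler_wpM2r// hM// !ler0_norm ?lerN2// ltW.
Qed.

Section log_cosh.
Context {R : realType} (A B : R).
Hypotheses (A0 : 0 <= A) (B0 : 0 <= B) (AB : 0 < A + B).

Let D y := A * expR y + B * expR (- y).
Let N y := A * expR y - B * expR (- y).
Let t := (A - B) / (A + B).

Let D_gt0 y : 0 < D y.
Proof.
rewrite /D lt_neqAle addr_ge0 ?mulr_ge0 ?expR_ge0// andbT eq_sym.
rewrite paddr_eq0 ?mulr_ge0 ?expR_ge0// !mulf_eq0 ![expR _ == 0]gt_eqF ?expR_gt0//.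
rewrite !orbF; apply/negP => /andP[/eqP A00 /eqP B00].
by move: AB; rewrite A00 B00 addr0 ltxx.
Qed.

Let dexpN (y : R) : is_derive y 1 (fun z : R => expR (- z)) (- expR (- y)).
Proof.
have h := @is_derive1_comp R expR -%R y _ _ (is_derive_expR _) (is_deriveNid _ _).
by apply: is_derive_eq; rewrite mulrN1.
Qed.

Let dA (y : R) : is_derive y 1 (fun z : R => A * expR z) (A * expR y).
Proof. exact: (is_deriveZ (f := expR)). Qed.

Let dB (y : R) : is_derive y 1 (fun z : R => B * expR (- z)) (B * - expR (- y)).
Proof. exact: (is_deriveZ (f := fun z => expR (- z))). Qed.

Let dD (y : R) : is_derive y 1 D (N y).
Proof.
apply: (is_derive_eq (is_deriveD (dA y) (dB y))).
by rewrite mulrN.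
Qed.

Let dN (y : R) : is_derive y 1 N (D y).
Proof.
apply: (is_derive_eq (is_deriveB (dA y) (dB y))).
by rewrite mulrN opprK.
Qed.

Let T y := N y / D y.

Let dlnD (y : R) : is_derive y 1 (fun z => ln (D z)) (T y).
Proof.
apply: (is_derive_eq (is_derive1_comp (is_derive1_ln (D_gt0 y)) (dD y))).
by rewrite mulrC.
Qed.

Let dDV (y : R) : is_derive y 1 (fun z => (D z)^-1) (- (D y)^-2 * N y).
Proof.
have D0 : D y != 0 by rewrite gt_eqF.
exact: (is_derive_eq (is_deriveV D0 (dD y))).
Qed.

(** Since [D' = N] and [N' = D], the logarithmic derivative [T] solves the Riccati equation of tanh
    whatever [A] and [B] are. Together with [T_le1], this is the source of the uniformity of all the
    bounds below. *)
Let dT (y : R) : is_derive y 1 T (1 - T y ^+ 2).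
Proof.
apply: (is_derive_eq (is_deriveM (dN y) (dDV y))).
rewrite /T /GRing.scale/=; have D0 : D y != 0 by rewrite gt_eqF.
by field.
Qed.

Let T_le1 y : `|T y| <= 1.
Proof.
rewrite /T normrM normfV (gtr0_norm (D_gt0 y)) ler_pdivrMr ?D_gt0// mul1r.
rewrite (le_trans (ler_normB _ _))// !ger0_norm ?mulr_ge0 ?expR_ge0//.
Qed.

Let T0 : T 0 = t.
Proof. by rewrite /T /t /N /D oppr0 expR0 !mulr1. Qed.

Let T_sub y : `|T y - t| <= `|y|.
Proof.
rewrite -T0 -[leRHS]mul1r; apply: (le_of_derive_bound dT) => z _.
have := T_le1 z; rewrite -(ler_pXn2r (n := 2)) ?nnegrE// expr1n real_normK ?num_real//.
move=> h; rewrite ger0_norm ?subr_ge0//; have := sqr_ge0 (T z); lra.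
Qed.

Let dlin (a y : R) : is_derive y 1 (fun z : R => a * z) a.
Proof.
apply: (is_derive_eq (is_deriveZ a (is_derive_id y 1))).
by rewrite /GRing.scale/= mulr1.
Qed.

(** The derivative of the left-hand side is the difference of two squares, [- (T + t) (T - t)]: the
    first factor is at most 2 in absolute value, the second at most [|z|] by [T_sub]. *)
Let T_sub2 y : `|T y - t - (1 - t ^+ 2) * y| <= 2 * `|y| * `|y|.
Proof.
pose h z := T z - (1 - t ^+ 2) * z.
have -> : T y - t - (1 - t ^+ 2) * y = h y - h 0 by rewrite /h T0 mulr0; ring.
apply: (@le_of_derive_bound _ h (fun z => (1 - T z ^+ 2) - (1 - t ^+ 2))).
  by move=> z; exact: (is_deriveB (dT z) (dlin _ z)).
move=> z zy; have -> : 1 - T z ^+ 2 - (1 - t ^+ 2) = - ((T z + t) * (T z - t)).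
  by ring.
rewrite normrN normrM ler_pM// ?(le_trans (T_sub z))//.
by rewrite (le_trans (ler_normD _ _))// -T0 (_ : 2 = 1 + 1)// lerD.
Qed.

(** The constant 2 is that of [T_sub2]: the derivative is bounded by its largest value on the
    segment instead of being integrated. *)
Lemma ln_cosh_taylor y :
  `|ln (A * expR y + B * expR (- y)) - ln (A + B) - t * y
     - (1 - t ^+ 2) / 2 * y ^+ 2| <= 2 * `|y| ^+ 3.
Proof.
pose h z := ln (D z) - (t * z + (1 - t ^+ 2) / 2 * z ^+ 2).
have D0 : D 0 = A + B by rewrite /D oppr0 expR0 !mulr1.
rewrite -[X in `|X|](_ : h y - h 0 = _); last by rewrite /h D0 /D; ring.
have -> : 2 * `|y| ^+ 3 = (2 * `|y| * `|y|) * `|y| by ring.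
apply: (@le_of_derive_bound _ h (fun z => T z - (t + (1 - t ^+ 2) * z))) => z.
  have dq : is_derive z 1 (fun z : R => (1 - t ^+ 2) / 2 * z ^+ 2) ((1 - t ^+ 2) * z).
    have h2 := is_deriveM (is_derive_id z 1) (is_derive_id z 1).
    apply: (is_derive_eq (is_deriveZ ((1 - t ^+ 2) / 2) h2)).
    by rewrite /GRing.scale/=; field.
  exact: (is_deriveB (dlnD z) (is_deriveD (dlin t z) dq)).
move=> zy; rewrite opprD addrA (le_trans (T_sub2 z))//.
by rewrite ler_pM// ?mulr_ge0// ler_pM.
Qed.

Lemma ln_cosh_slope : `|t| <= 1.
Proof. by rewrite -T0. Qed.

End log_cosh.

(* Measurability for the product sigma-algebra on [K -> R], tested on families
   of measurable functions so that no such sigma-algebra has to be built. *)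
Definition measurable_functional (R : realType) (K : Type) (F : (K -> R) -> R) :=
  forall d (T : measurableType d) (Y : K -> T -> R),
    (forall k, measurable_fun setT (Y k)) ->
    measurable_fun setT (fun w => F (fun k => Y k w)).

Definition upd (R : Type) (K : eqType) (x : K -> R) (k : K) (y : R) : K -> R :=
  fun k' => if k' == k then y else x k'.

(** * Maxima and soft maxima of sign forms *)

Section sign_forms.
Context {R : realType} {K : eqType} {S : finType} (s0 : S) (l : seq K)
  (e : S -> K -> R) (b : R).
Hypotheses (ul : uniq l) (e1 : forall s k, e s k = 1 \/ e s k = -1) (b0 : 0 < b).
Implicit Types (x : K -> R) (s : S) (k : K).

Definition lin s x := \sum_(k <- l) e s k * x k.

(** Over the reals, max has no neutral element. The iteration starts at the value of an actual
    configuration [s0], which leaves the maximum unchanged. *)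
Definition maxlin x := \big[Num.max/lin s0 x]_(s : S) lin s x.

Definition partition_function x := \sum_(s : S) expR (b * lin s x).

Definition softmax x := b^-1 * ln (partition_function x).

Lemma norm_sign s k : `|e s k| = 1.
Proof. by case: (e1 s k) => ->; rewrite ?normrN normr1. Qed.

Lemma lin_ext s x x' : {in l, x =1 x'} -> lin s x = lin s x'.
Proof. by move=> h; apply: eq_big_seq => k kl; rewrite h. Qed.

Lemma lin_upd s x k y : k \in l ->
  lin s (upd x k y) = lin s (upd x k 0) + e s k * y.
Proof.
move=> kl; rewrite /lin !(bigD1_seq k)//= /upd eqxx mulr0 add0r addrC.
congr (_ + _); apply: eq_bigr => k' /negbTE k'k.
by rewrite k'k.
Qed.

Lemma lin_lip s x k y y' : k \in l ->
  lin s (upd x k y) <= lin s (upd x k y') + `|y - y'|.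
Proof.
move=> kl; rewrite (lin_upd s x y kl) (lin_upd s x y' kl) -addrA lerD2l -lerBlDl -mulrBr.
by rewrite (le_trans (ler_norm _))// normrM norm_sign mul1r.
Qed.

Lemma norm_lin s x : `|lin s x| <= \sum_(k <- l) `|x k|.
Proof.
rewrite (le_trans (ler_norm_sum _ _ _))//; apply: ler_sum => k _.
by rewrite normrM norm_sign mul1r.
Qed.

Lemma le_maxlin s x : lin s x <= maxlin x.
Proof. exact: le_bigmax_cond. Qed.

Lemma maxlin_attained x : exists s, maxlin x = lin s x.
Proof.
rewrite /maxlin; elim/big_ind: _ => [|u v [s ->] [s' ->]|s _].
- by exists s0.
- by case: (leP (lin s x) (lin s' x)) => _; [exists s'|exists s].
- by exists s.
Qed.

Lemma maxlin_ext x x' : {in l, x =1 x'} -> maxlin x = maxlin x'.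
Proof.
move=> h; rewrite /maxlin (lin_ext s0 h).
by apply: eq_bigr => s _; exact: lin_ext.
Qed.

Lemma norm_maxlin x : `|maxlin x| <= \sum_(k <- l) `|x k|.
Proof. by have [s ->] := maxlin_attained x; exact: norm_lin. Qed.

Lemma maxlin_lip x k y y' : k \in l ->
  `|maxlin (upd x k y) - maxlin (upd x k y')| <= `|y - y'|.
Proof.
move=> kl; rewrite ler_norml; apply/andP; split.
  have [s ->] := maxlin_attained (upd x k y').
  rewrite lerNl opprB lerBlDr addrC (le_trans (lin_lip s x y' y kl))// distrC lerD2r.
  exact: le_maxlin.
have [s ->] := maxlin_attained (upd x k y).
rewrite lerBlDr addrC (le_trans (lin_lip s x y y' kl))// lerD2r; exact: le_maxlin.
Qed.

Lemma measurable_lin s : measurable_functional (lin s).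
Proof.
move=> d T Y mY; apply: measurable_sum => k.
exact: measurable_funM.
Qed.

Lemma measurable_maxlin : measurable_functional maxlin.
Proof.
move=> d T Y mY; rewrite /maxlin.
elim: (index_enum S) => [|s r IH].
  under eq_fun do rewrite big_nil; exact: measurable_lin.
under eq_fun do rewrite big_cons.
by apply: measurable_maxr => //; exact: measurable_lin.
Qed.

Lemma partition_function_gt0 x : 0 < partition_function x.
Proof.
rewrite /partition_function (bigD1 s0)//= ltr_wpDr ?expR_gt0//.
by apply: sumr_ge0 => s _; exact: expR_ge0.
Qed.

Lemma maxlin_le_softmax x : maxlin x <= softmax x.
Proof.
have [s ->] := maxlin_attained x.
rewrite /softmax -(ler_pM2l b0) mulrA mulfV ?mul1r ?gt_eqF//.
rewrite -[leLHS]expRK ler_ln ?posrE ?expR_gt0 ?partition_function_gt0//.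
rewrite /partition_function (bigD1 s)//= lerDl.
by apply: sumr_ge0 => s' _; exact: expR_ge0.
Qed.

Lemma softmax_le_maxlin x : softmax x <= maxlin x + b^-1 * ln #|S|%:R.
Proof.
have S0 : 0 < #|S|%:R :> R by rewrite ltr0n; apply/card_gt0P; exists s0.
rewrite /softmax -(ler_pM2l b0) mulrDr !mulrA mulfV ?mul1r ?gt_eqF//.
rewrite -[X in X + _]expRK -lnM ?posrE ?expR_gt0//.
rewrite ler_ln ?posrE ?partition_function_gt0 ?mulr_gt0 ?expR_gt0//.
rewrite mulr_natr -sumr_const; apply: ler_sum => s _.
by rewrite ler_expR ler_pM2l// le_maxlin.
Qed.

(** As [e s k] is a sign, [(1 + e s k) / 2] and [(1 - e s k) / 2] are the indicators of its two
    values. At a point whose coordinate [k] is 0, the two weights are the coefficients [A] and [B]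
    of the previous section. *)
Definition plus_weight k x := \sum_(s : S) (1 + e s k) / 2 * expR (b * lin s x).
Definition minus_weight k x := \sum_(s : S) (1 - e s k) / 2 * expR (b * lin s x).
(** The Gibbs average of [e s k], which for [k] in [l] is the partial derivative of [softmax] in the
    coordinate [k]. *)
Definition slope k x :=
  (plus_weight k x - minus_weight k x) / (plus_weight k x + minus_weight k x).

Let plus_minus k x : plus_weight k x + minus_weight k x = partition_function x.
Proof.
rewrite /plus_weight /minus_weight -big_split; apply: eq_bigr => s _ /=.
by field.
Qed.

Let plus_weight_ge0 k x : 0 <= plus_weight k x.
Proof.
apply: sumr_ge0 => s _; rewrite mulr_ge0 ?expR_ge0// divr_ge0//.
by case: (e1 s k) => ->; lra.
Qed.

Let minus_weight_ge0 k x : 0 <= minus_weight k x.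
Proof.
apply: sumr_ge0 => s _; rewrite mulr_ge0 ?expR_ge0// divr_ge0//.
by case: (e1 s k) => ->; lra.
Qed.

Let partition_upd k x y : k \in l -> partition_function (upd x k y) =
  plus_weight k (upd x k 0) * expR (b * y) +
  minus_weight k (upd x k 0) * expR (- (b * y)).
Proof.
move=> kl; rewrite /plus_weight /minus_weight !mulr_suml -big_split.
apply: eq_bigr => s _ /=; rewrite lin_upd// mulrDr expRD.
by case: (e1 s k) => ->; rewrite ?mul1r ?mulN1r ?mulrN ?opprK; field.
Qed.

Lemma norm_slope k x : `|slope k x| <= 1.
Proof. by apply: ln_cosh_slope => //; rewrite plus_minus partition_function_gt0. Qed.

(** [ln_cosh_taylor] at [b * y], divided by [b]: the remainder [2 |b y|^3] becomes [2 b^2 |y|^3]. *)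
Lemma softmax_taylor k x y : k \in l ->
  `|softmax (upd x k y) - softmax (upd x k 0) - slope k (upd x k 0) * y
     - b * (1 - slope k (upd x k 0) ^+ 2) / 2 * y ^+ 2| <= 2 * b ^+ 2 * `|y| ^+ 3.
Proof.
move=> kl; set u := upd x k 0.
have AB : 0 < plus_weight k u + minus_weight k u.
  by rewrite plus_minus partition_function_gt0.
have := ln_cosh_taylor (plus_weight_ge0 k u) (minus_weight_ge0 k u) AB (b * y).
rewrite -/(slope k u) plus_minus -partition_upd// => h.
have bn : b != 0 by rewrite gt_eqF.
rewrite /softmax -(ler_pM2l b0) -[X in X * `|_|](gtr0_norm b0) -normrM.
apply: le_trans (le_trans h _); last by rewrite normrM (gtr0_norm b0) le_eqVlt; apply/orP; left; apply/eqP; ring.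
by rewrite le_eqVlt; apply/orP; left; apply/eqP; congr `|_|; field.
Qed.

Let measurable_weight (c : S -> R) :
  measurable_functional (fun x => \sum_(s : S) c s * expR (b * lin s x)).
Proof.
move=> d T Y mY; apply: measurable_sum => s; apply: measurable_funM => //.
by apply: measurableT_comp => //; apply: measurable_funM => //; exact: measurable_lin.
Qed.

Lemma measurable_softmax : measurable_functional softmax.
Proof.
move=> d T Y mY; apply: measurable_funM => //; apply: measurableT_comp => //.
by have := measurable_weight (fun=> 1) mY; under eq_fun do under eq_bigr do rewrite mul1r.
Qed.

Lemma measurable_slope k : measurable_functional (slope k).
Proof.
move=> d T Y mY; have mA := measurable_weight (fun s => (1 + e s k) / 2) mY.
have mB := measurable_weight (fun s => (1 - e s k) / 2) mY.
have mZ : measurable_fun setT (fun w => partition_function (fun j => Y j w)).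
  have := measurable_weight (fun=> 1) mY.
  by under eq_fun do under eq_bigr do rewrite mul1r.
apply: measurable_funM; first exact: measurable_funB.
(* The partition function [Z] is positive, so its inverse can be written [expR (- ln Z)], a
   composition of measurable functions. *)
under eq_fun do rewrite plus_minus -[_^-1]lnK ?posrE ?invr_gt0 ?partition_function_gt0//
  lnV ?posrE ?partition_function_gt0//.
by do 3 apply: measurableT_comp => //.
Qed.

End sign_forms.

(** * Replacing entries one at a time *)

Section hybrids.
Context {d} {T : measurableType d} {R : realType} (P : probability T R)
  {K : choiceType} (Y : K + K -> {RV P >-> R}).
Implicit Types (D : seq K) (k : K) (w : T).

Definition hybrid D w : K -> R :=
  fun k => if k \in D then Y (inr k) w else Y (inl k) w.

(** Both copies of the entry [k] are excluded: a hybrid whose entry [k] is set to 0 is then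
    independent of the entry taken out and also of the one put in. *)
Definition away k : set (K + K) := [set u | u <> inl k /\ u <> inr k].

Lemma hybrid_inr D k w : hybrid (k :: D) w = upd (hybrid D w) k (Y (inr k) w).
Proof. by apply/funext => k'; rewrite /hybrid /upd inE; case: eqP => [->|]. Qed.

Lemma hybrid_inl D k w : k \notin D ->
  hybrid D w = upd (hybrid D w) k (Y (inl k) w).
Proof.
move=> kD; apply/funext => k'; rewrite /hybrid /upd; case: eqP => [->|//].
by rewrite (negbTE kD).
Qed.

Lemma meas_on_hybrid D k k' : k' != k ->
  meas_on Y (away k) (fun w => hybrid D w k').
Proof.
move=> k'k; rewrite /hybrid; case: (k' \in D); apply: meas_on_coord; split=> //.
  by case=> kk; rewrite kk eqxx in k'k.
by case=> kk; rewrite kk eqxx in k'k.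
Qed.

Lemma meas_on_upd0 D k k' :
  meas_on Y (away k) (fun w => upd (hybrid D w) k 0 k').
Proof.
rewrite /upd; have [_|k'k] := eqVneq k' k; first exact: measurable_cst.
exact: meas_on_hybrid.
Qed.

Lemma measurable_hybrid D k : measurable_fun setT (fun w => hybrid D w k).
Proof. by rewrite /hybrid; case: (k \in D). Qed.

Hypothesis indY : mutually_independent Y.

(** * Lindeberg's telescoping sum *)

Section lindeberg.
Variables (F : (K -> R) -> R) (p q : K -> (K -> R) -> R) (l : seq K)
  (c Cp Cq L M1 M2 : R).
Hypotheses (mF : measurable_functional F)
  (mp : forall k, measurable_functional (p k))
  (mq : forall k, measurable_functional (q k))
  (growthF : forall x, `|F x| <= c + \sum_(k <- l) `|x k|)
  (boundp : forall k x, `|p k x| <= Cp) (boundq : forall k x, `|q k x| <= Cq)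
  (L0 : 0 <= L)
  (taylorF : forall x k y, k \in l ->
     `|F (upd x k y) - F (upd x k 0) - p k (upd x k 0) * y
        - q k (upd x k 0) * y ^+ 2| <= L * `|y| ^+ 3)
  (Y3 : forall u, rint P (fun w => `|Y u w| ^+ 3))
  (EY : forall u, \int[P]_w Y u w = 0)
  (EY2 : forall u, \int[P]_w (Y u w ^+ 2) = 1)
  (EY3l : forall k, \int[P]_w (`|Y (inl k) w| ^+ 3) <= M1)
  (EY3r : forall k, \int[P]_w (`|Y (inr k) w| ^+ 3) <= M2).

Let Y2 u : rint P (fun w => Y u w ^+ 2).
Proof. exact: rint_sqr_of_cube. Qed.

Let Y1 u : rint P (Y u).
Proof. exact: rint_of_sqr. Qed.

Lemma rint_growth (x : T -> K -> R) :
  (forall k, rint P (fun w => x w k)) -> rint P (fun w => F (x w)).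
Proof.
move=> ix; apply: (@rint_le _ _ _ _ _ (fun w => c + \sum_(k <- l) `|x w k|)).
- by apply: (@mF _ T (fun k w => x w k)) => k; exact: rint_measurable (ix k).
- by move=> w; exact: le_trans (growthF _) (ler_norm _).
- by apply: rintD; [exact: rint_cst|apply: rint_sum => k; exact: rint_norm].
Qed.

Lemma rint_hybrid D k : rint P (fun w => hybrid D w k).
Proof. by rewrite /hybrid; case: (k \in D). Qed.

Lemma rint_upd (x : T -> K -> R) k y : (forall j, rint P (fun w => x w j)) ->
  rint P y -> forall j, rint P (fun w => upd (x w) k (y w) j).
Proof. by move=> ix iy j; rewrite /upd; case: (j == k). Qed.

(** The coefficients are evaluated with the entry [k] set to 0, hence independent of [Y u]: the
    linear term has mean 0 and the quadratic one the mean of [q k]. What is subtracted on the left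
    does not depend on which copy [u] is. *)
Lemma Ex_upd_taylor D k u : k \in l -> u = inl k \/ u = inr k ->
  `|\int[P]_w F (upd (hybrid D w) k (Y u w)) - \int[P]_w F (upd (hybrid D w) k 0)
    - \int[P]_w q k (upd (hybrid D w) k 0)| <= L * \int[P]_w (`|Y u w| ^+ 3).
Proof.
move=> kl uk.
have dis i : away k i -> ~ [set u] i by move=> [i1 i2] /= iu; case: uk => uE; subst.
have mpJ : meas_on Y (away k) (fun w => p k (upd (hybrid D w) k 0)).
  by apply: (@mp k _ (cyl_sigma Y (away k)) (fun j w => upd (hybrid D w) k 0 j)) => j; exact: meas_on_upd0.
have mqJ : meas_on Y (away k) (fun w => q k (upd (hybrid D w) k 0)).
  by apply: (@mq k _ (cyl_sigma Y (away k)) (fun j w => upd (hybrid D w) k 0 j)) => j; exact: meas_on_upd0.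
have mY : meas_on Y [set u] (Y u) by exact: meas_on_coord.
have mY2 : meas_on Y [set u] (fun w => Y u w ^+ 2) by exact: measurable_funX.
have ip : rint P (fun w => p k (upd (hybrid D w) k 0)).
  by apply: rint_bounded => //; exact: meas_on_measurable mpJ.
have iq : rint P (fun w => q k (upd (hybrid D w) k 0)).
  by apply: rint_bounded => //; exact: meas_on_measurable mqJ.
have [ipY EpY] := Ex_indep indY dis mpJ mY ip (Y1 u).
have [iqY EqY] := Ex_indep indY dis mqJ mY2 iq (Y2 u).
rewrite EY mulr0 in EpY; rewrite EY2 mulr1 in EqY.
have iF := rint_growth (rint_upd k (rint_hybrid D) (Y1 u)).
have iF0 := rint_growth (rint_upd k (rint_hybrid D) (rint_cst P 0)).
have iB1 := rintB iF iF0; have iB2 := rintB iB1 ipY; have iB3 := rintB iB2 iqY.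
have -> : \int[P]_w F (upd (hybrid D w) k (Y u w))
    - \int[P]_w F (upd (hybrid D w) k 0) - \int[P]_w q k (upd (hybrid D w) k 0) =
    \int[P]_w (F (upd (hybrid D w) k (Y u w)) - F (upd (hybrid D w) k 0)
      - p k (upd (hybrid D w) k 0) * Y u w
      - q k (upd (hybrid D w) k 0) * Y u w ^+ 2).
  by rewrite (ExB iB2 iqY) (ExB iB1 ipY) (ExB iF iF0) EpY EqY subr0.
rewrite (le_trans (normr_Ex iB3))//.
rewrite -ExZ//; apply: le_Ex.
- exact: rint_norm.
- exact: rintZ.
- by move=> w; exact: taylorF.
Qed.

Lemma lindeberg D : uniq D -> {subset D <= l} ->
  `|\int[P]_w F (hybrid [::] w) - \int[P]_w F (hybrid D w)| <=
  (size D)%:R * (L * (M1 + M2)).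
Proof.
elim: D => [|k D IH] /=; first by rewrite subrr normr0 mul0r.
move=> /andP[kD uD] Dl.
have kl : k \in l by apply: Dl; rewrite inE eqxx.
have {}IH := IH uD (fun j jD => Dl _ (mem_behead (s := k :: D) jD)).
rewrite -natr1 mulrDl mul1r (le_trans (ler_distD (\int[P]_w F (hybrid D w)) _ _))//.
apply: lerD => //.
have hl := Ex_upd_taylor D kl (or_introl erefl).
have hr := Ex_upd_taylor D kl (or_intror erefl).
have -> : \int[P]_w F (hybrid D w) = \int[P]_w F (upd (hybrid D w) k (Y (inl k) w)).
  by apply: eq_Ex => w; rewrite -hybrid_inl.
have -> : \int[P]_w F (hybrid (k :: D) w) =
    \int[P]_w F (upd (hybrid D w) k (Y (inr k) w)).
  by apply: eq_Ex => w; rewrite hybrid_inr.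
move: hl hr; set a := \int[P]_w F (upd _ _ (Y (inl k) w)).
set a' := \int[P]_w F (upd _ _ (Y (inr k) w)).
set f0 := \int[P]_w F _; set q0 := \int[P]_w q _ _ => hl hr.
(* The terms up to order two are common to the two copies and cancel, leaving only the two cubic
   remainders. *)
have -> : a - a' = (a - f0 - q0) - (a' - f0 - q0) by ring.
rewrite (le_trans (ler_normB _ _))// mulrDr; apply: lerD.
  by apply: (le_trans hl); rewrite ler_wpM2l.
by apply: (le_trans hr); rewrite ler_wpM2l.
Qed.

End lindeberg.

(** * Variance by resampling *)

Section efron_stein.
Variables (F : (K -> R) -> R) (l : seq K).
Hypotheses (mF : measurable_functional F)
  (growthF : forall x, `|F x| <= \sum_(k <- l) `|x k|)
  (lipF : forall x k y y', k \in l ->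
     `|F (upd x k y) - F (upd x k y')| <= `|y - y'|)
  (Y2 : forall u, rint P (fun w => Y u w ^+ 2))
  (EY2 : forall u, \int[P]_w (Y u w ^+ 2) = 1)
  (lawY : forall k B, measurable B -> P (Y (inl k) @^-1` B) = P (Y (inr k) @^-1` B)).

Lemma rint_growth_sqr (x : T -> K -> R) :
  (forall k, measurable_fun setT (fun w => x w k)) ->
  (forall k, rint P (fun w => x w k ^+ 2)) -> rint P (fun w => F (x w) ^+ 2).
Proof.
move=> mx ix; apply: (@rint_le _ _ _ _ _ (fun w => (\sum_(k <- l) `|x w k|) ^+ 2)).
- by apply: measurable_funX; apply: (@mF _ T (fun k w => x w k)).
- move=> w; rewrite !normrX lerXn2r ?nnegrE//.
  exact: le_trans (growthF _) (ler_norm _).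
- elim: l => [|k s IH].
    by under [X in rint _ X]eq_fun do rewrite big_nil; exact: rint_cst.
  under [X in rint _ X]eq_fun do rewrite big_cons.
  apply: rint_sqrD => //.
  + exact: measurableT_comp.
  + by apply: measurable_sum => j; exact: measurableT_comp.
  + by under [X in rint _ X]eq_fun do rewrite real_normK ?num_real//.
Qed.

Let mupd (x : T -> K -> R) k y : (forall j, measurable_fun setT (fun w => x w j)) ->
  measurable_fun setT y ->
  forall j, measurable_fun setT (fun w => upd (x w) k (y w) j).
Proof. by move=> mx my j; rewrite /upd; case: (j == k). Qed.

Let rupd (x : T -> K -> R) k y : (forall j, rint P (fun w => x w j ^+ 2)) ->
  rint P (fun w => y w ^+ 2) ->
  forall j, rint P (fun w => upd (x w) k (y w) j ^+ 2).
Proof. by move=> ix iy j; rewrite /upd; case: (j == k). Qed.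

Let mF' (x : T -> K -> R) : (forall k, measurable_fun setT (fun w => x w k)) ->
  measurable_fun setT (fun w => F (x w)).
Proof. by move=> mx; exact: (@mF _ T (fun k w => x w k)). Qed.

Let rhybrid D k : rint P (fun w => hybrid D w k ^+ 2).
Proof. by rewrite /hybrid; case: (k \in D). Qed.

Lemma rint_F_hybrid_sqr D : rint P (fun w => F (hybrid D w) ^+ 2).
Proof. by apply: rint_growth_sqr => // k; exact: measurable_hybrid. Qed.

Lemma measurable_F_hybrid D : measurable_fun setT (fun w => F (hybrid D w)).
Proof. by apply: mF' => k; exact: measurable_hybrid. Qed.

(* Resampling the coordinate [k] leaves the expectation unchanged once the
   first factor is made independent of it, at a cost [|Y (inl k)|]. *)
Lemma resample_step D k : k \in l -> k \notin D ->
  `|\int[P]_w (F (hybrid [::] w) * F (hybrid D w))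
    - \int[P]_w (F (hybrid [::] w) * F (hybrid (k :: D) w))| <= 2.
Proof.
move=> kl kD.
pose f0 w := F (upd (hybrid [::] w) k 0).
pose fl w := F (upd (hybrid D w) k (Y (inl k) w)).
pose fr w := F (upd (hybrid D w) k (Y (inr k) w)).
have lE w : F (hybrid D w) = fl w by rewrite /fl -hybrid_inl.
have rE w : F (hybrid (k :: D) w) = fr w by rewrite /fr hybrid_inr.
have mh D' j := measurable_hybrid D' j.
have m0 : measurable_fun setT f0 by apply: mF'; exact: mupd.
have i0 : rint P (fun w => f0 w ^+ 2).
  apply: rint_growth_sqr; first exact: mupd.
  by apply: rupd => //; rewrite expr0n/=; exact: rint_cst.
have ml : measurable_fun setT fl by apply: mF'; exact: mupd.
have il : rint P (fun w => fl w ^+ 2).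
  by apply: rint_growth_sqr; [exact: mupd|exact: rupd].
have mr : measurable_fun setT fr by apply: mF'; exact: mupd.
have ir : rint P (fun w => fr w ^+ 2).
  by apply: rint_growth_sqr; [exact: mupd|exact: rupd].
have i0l := rint_mul2 m0 ml i0 il.
have i0r := rint_mul2 m0 mr i0 ir.
have swap : \int[P]_w (f0 w * fl w) = \int[P]_w (f0 w * fr w).
  pose S := (cyl_sigma Y (away k) * R)%type.
  pose h (z : S) := F (upd (hybrid [::] z.1) k 0) * F (upd (hybrid D z.1) k z.2).
  apply: (@Ex_swap _ _ _ _ _ _ indY (away k) [set inl k] [set inr k]
    (Y (inl k)) (Y (inr k)) h) => //.
  - by move=> i [].
  - by move=> i [].
  - exact: meas_on_coord.
  - exact: meas_on_coord.
  - exact: lawY.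
  - have mz (f : T -> R) : meas_on Y (away k) f -> measurable_fun setT (fun z : S => f z.1).
      by move=> mf; apply: (measurableT_comp mf).
    apply: measurable_funM.
      by apply: (@mF _ S (fun j z => upd (hybrid [::] z.1) k 0 j)) => j;
         exact: (mz _ (@meas_on_upd0 [::] k j)).
    apply: (@mF _ S (fun j z => upd (hybrid D z.1) k z.2 j)) => j.
    rewrite /upd; have [_|jk] := eqVneq j k; first exact: measurable_snd.
    exact: (mz _ (@meas_on_hybrid D k j jk)).
pose f w := F (hybrid [::] w).
have mf : measurable_fun setT f by exact: measurable_F_hybrid.
have iff : rint P (fun w => f w ^+ 2) by exact: rint_F_hybrid_sqr.
have ifl := rint_mul2 mf ml iff il.
have ifr := rint_mul2 mf mr iff ir.
have -> : \int[P]_w (F (hybrid [::] w) * F (hybrid D w)) = \int[P]_w (f w * fl w).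
  by apply: eq_Ex => w; rewrite lE.
have -> : \int[P]_w (F (hybrid [::] w) * F (hybrid (k :: D) w)) = \int[P]_w (f w * fr w).
  by apply: eq_Ex => w; rewrite rE.
(* Subtracting the vanishing difference given by [swap] turns the integrand into the product
   [(f - f0) (fl - fr)], both factors of which are controlled by the entry [k] alone. *)
have -> : \int[P]_w (f w * fl w) - \int[P]_w (f w * fr w) =
    \int[P]_w (f w * fl w - f w * fr w - (f0 w * fl w - f0 w * fr w)).
  by rewrite ExB ?ExB ?swap ?subrr ?subr0//; exact: rintB.
have ii : rint P (fun w => f w * fl w - f w * fr w - (f0 w * fl w - f0 w * fr w)).
  by apply: rintB; exact: rintB.
rewrite (le_trans (normr_Ex ii))//.
(* With u and v the absolute values of the two copies, the Lipschitz bound gives [u (u + v)], at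
   most [3/2 u^2 + 1/2 v^2]. Unit second moments make the mean 2. *)
apply: (@le_trans _ _ (\int[P]_w (3 / 2 * Y (inl k) w ^+ 2 + 1 / 2 * Y (inr k) w ^+ 2))).
  apply: le_Ex; [exact: rint_norm|by apply: rintD; exact: rintZ|] => w.
  have -> : f w * fl w - f w * fr w - (f0 w * fl w - f0 w * fr w) =
    (f w - f0 w) * (fl w - fr w) by ring.
  rewrite normrM.
  have h1 : `|f w - f0 w| <= `|Y (inl k) w|.
    rewrite /f /f0 {1}(@hybrid_inl [::] k)//.
    by apply: (le_trans (lipF _ _ _ kl)); rewrite subr0.
  have h2 : `|fl w - fr w| <= `|Y (inl k) w| + `|Y (inr k) w|.
    by apply: (le_trans (lipF _ _ _ kl)); exact: ler_normB.
  apply: (le_trans (ler_pM _ _ h1 h2)) => //.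
  rewrite -(real_normK (num_real (Y (inl k) w))) -(real_normK (num_real (Y (inr k) w))).
  have := sqr_ge0 (`|Y (inl k) w| - `|Y (inr k) w|); nra.
rewrite ExD; [|exact: rintZ|exact: rintZ].
by rewrite !ExZ// !EY2; lra.
Qed.

(** For [D = l] and an [F] that depends on the entries of [l] only, the two factors of the second
    integral are independent copies, and the left-hand side is the variance of [F]. *)
Lemma resample D : uniq D -> {subset D <= l} ->
  `|\int[P]_w (F (hybrid [::] w) ^+ 2)
    - \int[P]_w (F (hybrid [::] w) * F (hybrid D w))| <= (size D)%:R * 2.
Proof.
elim: D => [|k D IH] /=.
  rewrite mul0r normr_le0 subr_eq0 => _ _; apply/eqP.
  by apply: eq_Ex => w; rewrite expr2.
move=> /andP[kD uD] Dl.
have kl : k \in l by apply: Dl; rewrite inE eqxx.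
have {}IH := IH uD (fun j jD => Dl _ (mem_behead (s := k :: D) jD)).
rewrite -natr1 mulrDl mul1r.
rewrite (le_trans (ler_distD (\int[P]_w (F (hybrid [::] w) * F (hybrid D w))) _ _))//.
by apply: lerD => //; exact: resample_step.
Qed.

End efron_stein.

End hybrids.

(** * Moments of the standard normal law *)

Section gaussian_integrals.
Context {R : realType}.
Notation leb := (@lebesgue_measure R).

Let phi (x : R) := expR (- x ^+ 2 / 2).

Let phi_ge0 x : 0 <= phi x. Proof. exact: expR_ge0. Qed.

Let dphi (x : R) : is_derive x 1 phi (- x * phi x).
Proof.
have h2 := is_deriveM (is_derive_id x 1) (is_derive_id x 1).
have h3 := is_deriveZ (- 2^-1 : R) h2.
have -> : phi = fun z => expR (- 2^-1 * (z * z)).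
  by apply/funext => z; rewrite /phi; congr expR; field.
apply: (is_derive_eq (is_derive1_comp (is_derive_expR _) h3)).
by rewrite /GRing.scale/=; field.
Qed.

Let cphi : continuous phi.
Proof.
by move=> x; apply: differentiable_continuous; apply/derivable1_diffP; exact: ex_derive.
Qed.

Let cmono n : continuous (fun x : R => x ^+ n * phi x).
Proof. by move=> x; apply: cvgM; [exact: exprn_continuous|exact: cphi]. Qed.

Let mmono n : measurable_fun setT (fun x : R => x ^+ n * phi x).
Proof. exact: continuous_measurable_fun. Qed.

(** [- (x^2 + 2) phi] is an antiderivative of [x^3 phi], so this limit is the boundary term at
    infinity. It also dominates the boundary term [x phi] of the second moment. *)
Let phi_decay : (x ^+ 2 + 2) * phi x @[x --> +oo] --> (0 : R).
Proof.
apply: (@squeeze_cvgr _ _ _ _ (cst 0) (fun x => 8 * x^-1)).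
- near=> x; have x0 : 0 < x by near: x; exact: nbhs_pinfty_gt.
  apply/andP; split; first by rewrite mulr_ge0// addr_ge0// sqr_ge0.
  rewrite ler_pdivlMr//.
  (* [phi x] is the inverse square of [expR (x^2 / 4)], which is at least [a]. As [x^2 + 2 <= 8 a]
     and [x <= a], the product with [x] is at most [8 a a^-2 a = 8]. *)
  pose a := 1 + x ^+ 2 / 4.
  have a0 : 0 < a by rewrite ltr_pwDl// divr_ge0// sqr_ge0.
  have ha : phi x <= a ^- 2.
    rewrite /phi (_ : - x ^+ 2 / 2 = - (x ^+ 2 / 4 + x ^+ 2 / 4)); last by field.
    rewrite expRN lef_pV2 ?posrE ?expR_gt0 ?exprn_gt0// expRD -expr2.
    by rewrite lerXn2r ?nnegrE ?expR_ge0 ?(ltW a0)// /a expR_ge1Dx.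
  have xa : x <= a by have := sqr_ge0 (x / 2 - 1); rewrite /a; lra.
  have x2a : x ^+ 2 + 2 <= 8 * a by have := sqr_ge0 x; rewrite /a; lra.
  apply: (@le_trans _ _ (8 * a * a ^- 2 * a)); last first.
    by rewrite le_eqVlt; apply/orP; left; apply/eqP; field; rewrite gt_eqF.
  have xx : 0 <= x ^+ 2 by exact: sqr_ge0.
  apply: ler_pM xa; [by rewrite mulr_ge0// addr_ge0|exact: ltW|].
  by apply: ler_pM x2a ha; rewrite ?addr_ge0.
- exact: cvg_cst.
- rewrite -[X in _ --> X](mulr0 8); apply: cvgMl_tmp => //=.
  apply/gtr0_cvgV0; last exact: cvg_id.
  by near=> x; near: x; exact: nbhs_pinfty_gt.
Unshelve. all: by end_near. Qed.

Let int_cube : (\int[leb]_(x in `[0%R, +oo[) (x ^+ 3 * phi x)%:E = 2%:E)%E.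
Proof.
pose F (x : R) := - ((x ^+ 2 + 2) * phi x).
have dF (x : R) : is_derive x 1 F (x ^+ 3 * phi x).
  have h2 := is_deriveM (is_derive_id x 1) (is_derive_id x 1).
  have h3 := is_deriveD h2 (is_derive_cst (2 : R) x 1).
  apply: (is_derive_eq (is_deriveN (is_deriveM h3 (dphi x)))).
  transitivity (- ((x * x + 2) * (- x * phi x) + phi x * (x * 1 + x * 1 + 0))) => //.
  by ring.
rewrite (@ge0_continuous_FTC2y _ _ F 0 0).
- rewrite sub0e -EFinN /F expr0n/= /phi expr0n/= oppr0 mul0r expR0; congr (_%:E).
  by ring.
- by move=> x x0; rewrite mulr_ge0// exprn_ge0.
- exact/continuous_subspaceT/cmono.
- by rewrite -[X in _ --> X]oppr0; apply: cvgN.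
- by move=> x _; exact: ex_derive.
- apply: cvg_at_right_filter; apply: differentiable_continuous.
  by apply/derivable1_diffP; exact: ex_derive.
- by move=> x _; rewrite derive1E; exact: derive_val.
Qed.

Let int_expN : (\int[leb]_(x in `[0%R, +oo[) (2 * expR (- x))%:E = 2%:E)%E.
Proof.
pose F (x : R) := - (2 * expR (- x)).
have dE (x : R) : is_derive x 1 (fun z : R => 2 * expR (- z)) (- (2 * expR (- x))).
  have h := @is_derive1_comp R expR -%R x _ _ (is_derive_expR _) (is_deriveNid _ _).
  apply: (is_derive_eq (is_deriveZ (2 : R) h)).
  by rewrite /GRing.scale/=; ring.
have dF (x : R) : is_derive x 1 F (2 * expR (- x)).
  by apply: (is_derive_eq (is_deriveN (dE x))); rewrite opprK.
rewrite (@ge0_continuous_FTC2y _ _ F 0 0).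
- by rewrite sub0e -EFinN /F oppr0 expR0 mulr1 opprK.
- by move=> x x0; rewrite mulr_ge0// expR_ge0.
- apply: continuous_subspaceT => x; apply: differentiable_continuous.
  by apply/derivable1_diffP; exact: ex_derive.
- rewrite -[X in _ --> X]oppr0 -[X in - X](mulr0 2); apply: cvgN; apply: cvgMl_tmp.
  exact: cvgr_expR.
- by move=> x _; exact: ex_derive.
- apply: cvg_at_right_filter; apply: differentiable_continuous.
  by apply/derivable1_diffP; exact: ex_derive.
- by move=> x _; rewrite derive1E; exact: derive_val.
Qed.

(** Integration by parts: [(x^2 - 1) phi] is the derivative of [- x phi], which vanishes at 0 and at
    infinity. *)
Let int_sqr : (\int[leb]_(x in `[0%R, +oo[) (x ^+ 2 * phi x)%:E =
  \int[leb]_(x in `[0%R, +oo[) (phi x)%:E)%E.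
Proof.
pose F (x : R) := - (x * phi x) - 2 * expR (- x).
(* [ge0_continuous_FTC2y] wants a nonnegative integrand: [2 * expR (- x)]
   compensates the sign of [x ^+ 2 - 1] on [0, 1]. *)
pose f (x : R) := (x ^+ 2 - 1) * phi x + 2 * expR (- x).
have dE (x : R) : is_derive x 1 (fun z : R => 2 * expR (- z)) (- (2 * expR (- x))).
  have h := @is_derive1_comp R expR -%R x _ _ (is_derive_expR _) (is_deriveNid _ _).
  apply: (is_derive_eq (is_deriveZ (2 : R) h)).
  by rewrite /GRing.scale/=; ring.
have cE : continuous (fun z : R => 2 * expR (- z)).
  by move=> x; apply: differentiable_continuous; apply/derivable1_diffP; exact: ex_derive.
have dF (x : R) : is_derive x 1 F (f x).
  have h2 := is_deriveN (is_deriveM (is_derive_id x 1) (dphi x)).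
  apply: (is_derive_eq (is_deriveB h2 (dE x))).
  by rewrite /GRing.scale/= /f; ring.
have f0 (x : R) : 0 <= x -> 0 <= f x.
  move=> x0; rewrite /f; have [x1|x1] := leP 1 x.
    by rewrite addr_ge0 ?mulr_ge0 ?expR_ge0// subr_ge0 exprn_ege1.
  (* On [0, 1], [phi <= 1] and [expR (- x) >= 1 - x] give [f x >= - (1 - x^2) + 2 (1 - x) = (1 -
     x)^2]. *)
  have p1 : phi x <= 1.
    by rewrite /phi -[leRHS]expR0 ler_expR mulNr oppr_le0 divr_ge0// sqr_ge0.
  have e1 : 1 - x <= expR (- x) by rewrite expR_ge1Dx.
  have : (1 - x ^+ 2) * phi x <= (1 - x ^+ 2) * 1.
    by rewrite ler_wpM2l// subr_ge0 exprn_ile1// ltW.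
  have : 0 <= x * (1 - x) by rewrite mulr_ge0// subr_ge0 ltW.
  have : 0 <= (1 - x) * (1 - x) by rewrite -expr2 sqr_ge0.
  move=> h1 h2 h3; nra.
have cf : continuous f.
  move=> x; apply: cvgD; last exact: cE.
  apply: cvgM; last exact: cphi.
  by apply: cvgB; [exact: exprn_continuous|exact: cvg_cst].
have mE : measurable_fun setT (fun z : R => 2 * expR (- z)).
  exact: continuous_measurable_fun.
have mf : measurable_fun setT f by exact: continuous_measurable_fun.
have mphi : measurable_fun setT phi by exact: continuous_measurable_fun.
have If : (\int[leb]_(x in `[0%R, +oo[) (f x)%:E = 2%:E)%E.
  rewrite (@ge0_continuous_FTC2y _ f F 0 0).
  - by rewrite sub0e -EFinN /F mul0r oppr0 expR0 mulr1 sub0r opprK.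
  - exact: f0.
  - exact: continuous_subspaceT.
  - rewrite -[X in _ --> X](subr0 0) -{2}(mulr0 2) -{1}oppr0; apply: cvgB; last first.
      by apply: cvgMl_tmp; exact: cvgr_expR.
    apply: cvgN; apply: (@squeeze_cvgr _ _ _ _ (cst 0) _ _ _ _ _ phi_decay).
      near=> x; have x0 : 0 < x by near: x; exact: nbhs_pinfty_gt.
      rewrite mulr_ge0 ?(ltW x0)//= ler_wpM2r//.
      by have := sqr_ge0 (x - 1); nra.
    exact: cvg_cst.
  - by move=> x _; exact: ex_derive.
  - apply: cvg_at_right_filter; apply: differentiable_continuous.
    by apply/derivable1_diffP; exact: ex_derive.
  - by move=> x _; rewrite derive1E; exact: derive_val.
have split (u v : R -> R) : measurable_fun setT u -> measurable_fun setT v ->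
    (forall x : R, 0 <= x -> 0 <= u x) -> (forall x : R, 0 <= x -> 0 <= v x) ->
    (\int[leb]_(x in `[0%R, +oo[) (u x + v x)%:E =
     \int[leb]_(x in `[0%R, +oo[) (u x)%:E + \int[leb]_(x in `[0%R, +oo[) (v x)%:E)%E.
  move=> mu mv u0 v0; rewrite -ge0_integralD//=.
  - by move=> x; rewrite in_itv/= andbT lee_fin; exact: u0.
  - by apply/measurable_EFinP; exact: measurable_funTS.
  - by move=> x; rewrite in_itv/= andbT lee_fin; exact: v0.
  - by apply/measurable_EFinP; exact: measurable_funTS.
have E0 (x : R) : 0 <= x -> 0 <= 2 * expR (- x) by rewrite mulr_ge0// expR_ge0.
have := split _ _ (mmono 2) mE (fun x x0 => mulr_ge0 (exprn_ge0 2 x0) (phi_ge0 x)) E0.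
have -> : (\int[leb]_(x in `[0%R, +oo[) (x ^+ 2 * phi x + 2 * expR (- x))%:E =
    \int[leb]_(x in `[0%R, +oo[) (f x + phi x)%:E)%E.
  by apply: eq_integral => x _; congr (_%:E); rewrite /f; ring.
rewrite split// If int_expN (addeC 2%:E) => /(congr1 (fun z => z - 2%:E)%E).
by rewrite !addeK.
Unshelve. all: by end_near. Qed.

Let sym_int (f : R -> R) : (forall x, 0 <= f x) -> continuous f ->
  (forall x, f (- x) = f x) ->
  (\int[leb]_x (f x)%:E = 2%:E * \int[leb]_(x in `[0%R, +oo[) (f x)%:E)%E.
Proof.
move=> f0 cf sf; rewrite ge0_symfun_integralT//; last by move=> x /=; rewrite sf.
by rewrite -set_itvcy.
Qed.

Let phiN x : phi (- x) = phi x. Proof. by rewrite /phi sqrrN. Qed.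

Let cabs n : continuous (fun x : R => `|x| ^+ n * phi x).
Proof.
move=> x; apply: cvgM; last exact: cphi.
apply: (@continuous_comp _ _ _ (fun x : R => `|x|) (fun x => x ^+ n)).
  exact: norm_continuous.
exact: exprn_continuous.
Qed.

Let abs_ge0 n x : 0 <= `|x| ^+ n * phi x.
Proof. by rewrite mulr_ge0// exprn_ge0. Qed.

Let absN n x : `|- x| ^+ n * phi (- x) = `|x| ^+ n * phi x.
Proof. by rewrite normrN phiN. Qed.

Let intT_cube : (\int[leb]_x (`|x| ^+ 3 * phi x)%:E = 4%:E)%E.
Proof.
rewrite (sym_int (abs_ge0 3) (@cabs 3) (absN 3)).
have -> : (\int[leb]_(x in `[0%R, +oo[) (`|x| ^+ 3 * phi x)%:E =
    \int[leb]_(x in `[0%R, +oo[) (x ^+ 3 * phi x)%:E)%E.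
  apply: eq_integral => x; rewrite inE/= in_itv/= andbT => x0.
  by rewrite ger0_norm.
by rewrite int_cube -EFinM; congr (_%:E); ring.
Qed.

Let intT_sqr : (\int[leb]_x (x ^+ 2 * phi x)%:E = \int[leb]_x (phi x)%:E)%E.
Proof.
have s0 x : 0 <= x ^+ 2 * phi x by rewrite mulr_ge0// sqr_ge0.
have sN x : (- x) ^+ 2 * phi (- x) = x ^+ 2 * phi x by rewrite sqrrN phiN.
by rewrite (sym_int s0 (@cmono 2) sN) (sym_int phi_ge0 cphi phiN) int_sqr.
Qed.

(** The vanishing of the mean, stated with nonnegative integrands: [x + |x|] is [2 x] on the
    positive half-line and 0 on the negative one. *)
Let intT_id : (\int[leb]_x ((x + `|x|) * phi x)%:E = \int[leb]_x (`|x| * phi x)%:E)%E.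
Proof.
have mabs : measurable_fun setT (fun x : R => `|x| * phi x).
  exact: (continuous_measurable_fun (@cabs 1)).
rewrite (sym_int (abs_ge0 1) (@cabs 1) (absN 1)).
rewrite -ge0_integralZl//=; last 2 first.
- by apply/measurable_EFinP; exact: measurable_funTS.
- by move=> x _; rewrite lee_fin; exact: (abs_ge0 1).
rewrite [RHS]integral_mkcond; apply: eq_integral => x _.
rewrite patchE; case: ifPn => [|]; rewrite ?notin_setE ?inE/= in_itv/= andbT.
  by move=> x0; rewrite ger0_norm// -EFinM; congr (_%:E); ring.
by move=> /negP; rewrite -ltNge => x0; rewrite ltr0_norm// subrr mul0r.
Qed.

Notation gam := (normal_prob (0 : R) 1).

Let pdfE x : normal_pdf (0 : R) 1 x = normal_peak (1 : R) * phi x.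
Proof.
rewrite normal_pdfE ?oner_eq0// /normal_fun subr0 /phi; congr (_ * expR (_ / _)).
by rewrite expr1n.
Qed.

Let integral_normal (f : R -> R) : gam.-integrable setT (EFin \o f) ->
  (\int[gam]_x (f x)%:E = \int[leb]_x (f x * normal_pdf 0 1 x)%:E)%E.
Proof.
move=> fi; have dom := @normal_prob_dominates R 0 1.
rewrite -(Radon_Nikodym_change_of_variables dom measurableT fi).
have mf := measurable_int _ fi.
have mp : measurable_fun setT (fun x => (normal_pdf (0 : R) 1 x)%:E).
  by apply/measurable_EFinP; exact: measurable_normal_pdf.
have iRN : leb.-integrable setT (Radon_Nikodym (charge_of_finite_measure gam) leb).
  by apply: Radon_Nikodym_integrable; exact: dom.
transitivity (\int[leb]_x ((f x)%:E * (normal_pdf 0 1 x)%:E))%E; last first.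
  by apply: eq_integral => x _; rewrite EFinM.
apply: ae_eq_integral => //.
- by apply: emeasurable_funM => //; exact: measurable_int iRN.
- exact: emeasurable_funM.
- apply: ae_eqe_mul2l; apply: integral_ae_eq => // E _ mE.
  by rewrite -Radon_Nikodym_integral.
Qed.

(** The truncations [min (f, n)] are bounded, hence integrable, and monotone convergence removes the
    truncation. Integrability of [f] is not presupposed, so the formula can serve to prove it for
    [|x|^3]. *)
Let ge0_integral_normal (f : R -> R) : measurable_fun setT f ->
  (forall x, 0 <= f x) ->
  (\int[gam]_x (f x)%:E = \int[leb]_x (f x * normal_pdf 0 1 x)%:E)%E.
Proof.
move=> mf f0; pose g n x := Num.min (f x) n%:R.
have mg n : measurable_fun setT (g n) by exact: measurable_minr.
have g0 n x : 0 <= g n x by rewrite /g le_min f0 ler0n.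
have gn x : {homo g^~ x : n m / (n <= m)%N >-> n <= m}.
  by move=> n m nm; rewrite /g le_min2 ?lexx// ler_nat.
have gcvg x : (g n x)%:E @[n --> \oo] --> (f x)%:E.
  apply: cvg_near_cst; near=> n; rewrite /g min_l//.
  by near: n; exact: nbhs_infty_ger.
have eg n : (\int[gam]_x (g n x)%:E = \int[leb]_x (g n x * normal_pdf 0 1 x)%:E)%E.
  apply: integral_normal; apply: (@rint_bounded _ _ _ gam n%:R _ (mg n)) => x.
  by rewrite ger0_norm// /g ge_min lexx orbT.
have l1 : (\int[gam]_x (g n x)%:E @[n --> \oo] --> \int[gam]_x (f x)%:E)%E.
  have -> : (\int[gam]_x (f x)%:E = \int[gam]_x limn (fun n => (g n x)%:E))%E.
    by apply: eq_integral => x _; rewrite (cvg_lim _ (gcvg x)).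
  apply: cvg_monotone_convergence => //.
  - by move=> n; apply/measurable_EFinP; exact: mg.
  - by move=> n x _; rewrite lee_fin.
  - by move=> x _ n m nm; rewrite lee_fin; exact: gn.
have l2 : (\int[leb]_x (g n x * normal_pdf 0 1 x)%:E @[n --> \oo] -->
    \int[leb]_x (f x * normal_pdf 0 1 x)%:E)%E.
  have pcvg x : (g n x * normal_pdf 0 1 x)%:E @[n --> \oo] -->
      (f x * normal_pdf 0 1 x)%:E.
    apply: cvg_near_cst; near=> n; congr (_ * _)%:E; rewrite /g min_l//.
    by near: n; exact: nbhs_infty_ger.
  have -> : (\int[leb]_x (f x * normal_pdf 0 1 x)%:E =
      \int[leb]_x limn (fun n => (g n x * normal_pdf 0 1 x)%:E))%E.
    by apply: eq_integral => x _; rewrite (cvg_lim _ (pcvg x)).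
  apply: cvg_monotone_convergence => //.
  - move=> n; apply/measurable_EFinP.
    exact: measurable_funM (mg n) (measurable_normal_pdf _ _).
  - by move=> n x _; rewrite lee_fin mulr_ge0// normal_pdf_ge0.
  - move=> x _ n m nm; rewrite lee_fin ler_wpM2r ?normal_pdf_ge0//.
    exact: gn.
have E : (fun n => \int[gam]_x (g n x)%:E)%E =
    (fun n => \int[leb]_x (g n x * normal_pdf 0 1 x)%:E)%E by apply/funext.
by rewrite E in l1; exact: (cvg_unique _ l1 l2).
Unshelve. all: by end_near. Qed.

Let scale_normal (f : R -> R) (h : R -> R) : measurable_fun setT f ->
  (forall x, 0 <= f x) -> (forall x, h x = f x * phi x) ->
  (\int[gam]_x (f x)%:E = (normal_peak (1 : R))%:E * \int[leb]_x (h x)%:E)%E.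
Proof.
move=> mf f0 hE; have mphi : measurable_fun setT phi by exact: continuous_measurable_fun.
have mh : measurable_fun setT h.
  have -> : h = fun x => f x * phi x by apply/funext.
  exact: measurable_funM.
rewrite ge0_integral_normal// -ge0_integralZl//=.
- by apply: eq_integral => x _; rewrite pdfE hE -EFinM; congr (_%:E); ring.
- exact/measurable_EFinP.
- by move=> x _; rewrite hE lee_fin mulr_ge0.
- by rewrite lee_fin normal_peak_ge0.
Qed.

Lemma rint_normal_cube : rint gam (fun x => `|x| ^+ 3).
Proof.
have m3 : measurable_fun setT (fun x : R => `|x| ^+ 3).
  by apply: measurable_funX; exact: normr_measurable.
apply/integrableP; split; first exact/measurable_EFinP.
have -> : (\int[gam]_x `|(EFin \o (fun x : R => `|x| ^+ 3)%R) x| =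
    \int[gam]_x (`|x| ^+ 3)%:E)%E.
  by apply: eq_integral => x _ /=; rewrite ger0_norm// exprn_ge0.
rewrite (scale_normal (h := fun x => `|x| ^+ 3 * phi x))//.
by rewrite intT_cube -EFinM ltry.
Qed.

(** By [intT_sqr] the second moment equals the total mass, so the normalising constant is never
    evaluated. *)
Lemma Ex_normal_sqr : \int[gam]_x (x ^+ 2) = 1.
Proof.
have m2 : measurable_fun setT (fun x : R => x ^+ 2) by exact: measurable_funX.
have s0 (x : R) : 0 <= x ^+ 2 by exact: sqr_ge0.
rewrite /Rintegral (scale_normal (h := fun x => x ^+ 2 * phi x) m2 s0)//.
rewrite intT_sqr -(scale_normal (f := fun=> 1))//; last by move=> x; rewrite mul1r.
exact: (Ex_cst gam 1).
Qed.

Lemma Ex_normal : \int[gam]_x x = 0.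
Proof.
have m1 : measurable_fun setT (@id R) by [].
have i1 : rint gam id.
  by apply: rint_of_sqr => //; apply: rint_sqr_of_cube => //; exact: rint_normal_cube.
have ia := rint_norm i1.
have : \int[gam]_x (x + `|x|) = \int[gam]_x `|x|.
  rewrite /Rintegral; congr fine.
  have ma : measurable_fun setT (fun x : R => `|x|) by exact: normr_measurable.
  have m2 : measurable_fun setT (fun x : R => x + `|x|) by exact: measurable_funD.
  have s0 (x : R) : 0 <= x + `|x|.
    by have := ler_norm (- x); rewrite normrN; lra.
  rewrite (scale_normal (h := fun x => (x + `|x|) * phi x) m2 s0)//.
  by rewrite intT_id -(scale_normal (f := fun x => `|x|) ma).
by rewrite ExD// => /eqP; rewrite -subr_eq0 addrK => /eqP.
Qed.

Let idR : R -> R := id.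

Let midR : measurable_fun setT (idR : measurableTypeR R -> R).
Proof. by move=> _ B mB; rewrite setTI. Qed.

(* [normal_prob] lives on [measurableTypeR R], whose measurable sets are those of
   [R] but under a different display. *)
Definition std_normal : probability R R :=
  distribution (normal_prob 0 1)
    (@mfun_Sub _ _ (measurableTypeR R) R idR (mem_set midR)).

Let law_std (A : set R) : measurable A ->
  gam ((idR : measurableTypeR R -> R) @^-1` A) = std_normal A.
Proof. by []. Qed.

Let m3 : measurable_fun setT (fun r : R => `|r| ^+ 3).
Proof. by apply: measurable_funX; exact: normr_measurable. Qed.

Lemma rint_std_normal_cube : rint std_normal (fun r => `|r| ^+ 3).
Proof. exact/(rint_law midR law_std m3)/rint_normal_cube. Qed.

Lemma Ex_std_normal_sqr : \int[std_normal]_r (r ^+ 2) = 1.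
Proof.
have m2 : measurable_fun setT (fun r : R => r ^+ 2) by exact: measurable_funX.
rewrite (Ex_law midR law_std m2); first exact: Ex_normal_sqr.
by apply: rint_sqr_of_cube => //; exact: rint_std_normal_cube.
Qed.

Lemma Ex_std_normal : \int[std_normal]_r r = 0.
Proof.
have mid : measurable_fun setT (@id R) by [].
rewrite (Ex_law midR law_std mid); first exact: Ex_normal.
apply: rint_of_sqr => //; apply: rint_sqr_of_cube => //.
exact: rint_std_normal_cube.
Qed.

End gaussian_integrals.

(** * Comparison and variance of maxima of sign forms *)

Section marginals.
Context d d' {T : measurableType d} {T' : measurableType d'} {R : realType}
  (P : probability T R) (Q : probability T' R).

Lemma law_fst (A : set T) : measurable A -> (P \x Q)%E (fst @^-1` A) = P A.
Proof.
move=> mA; have -> : fst @^-1` A = A `*` [set: T'].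
  by apply/seteqP; split => -[w w'] //= [].
rewrite product_measure1E//.
by rewrite [X in (_ * X)%E](_ : _ = 1%E) ?mule1//; exact: probability_setT.
Qed.

Lemma law_snd (A : set T') : measurable A -> (P \x Q)%E (snd @^-1` A) = Q A.
Proof.
move=> mA; have -> : snd @^-1` A = [set: T] `*` A.
  by apply/seteqP; split => -[w w'] //= [].
rewrite product_measure1E//.
by rewrite [X in (X * _)%E](_ : _ = 1%E) ?mul1e//; exact: probability_setT.
Qed.

End marginals.

Section moments.
Context d {T : measurableType d} {R : realType} (P : probability T R)
  (mu : probability R R) {K : choiceType} (x : K -> {RV P >-> R}).
Hypotheses (lawx : forall k A, measurable A -> P (x k @^-1` A) = mu A)
  (mu3 : rint mu (fun r => `|r| ^+ 3)) (mu1 : \int[mu]_r r = 0)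
  (mu2 : \int[mu]_r (r ^+ 2) = 1).

Let m3 : measurable_fun setT (fun r : R => `|r| ^+ 3).
Proof. by apply: measurable_funX; exact: normr_measurable. Qed.

Let m2 : measurable_fun setT (fun r : R => r ^+ 2).
Proof. exact: measurable_funX. Qed.

Let i2 : rint mu (fun r => r ^+ 2).
Proof. exact: rint_sqr_of_cube. Qed.

Let mx k : measurable_fun setT (x k). Proof. exact: measurable_funPT. Qed.

Lemma rint_cube_law k : rint P (fun w => `|x k w| ^+ 3).
Proof. exact: (rint_law (mx k) (lawx k) m3).1. Qed.

Lemma Ex_cube_law k : \int[P]_w (`|x k w| ^+ 3) = \int[mu]_r (`|r| ^+ 3).
Proof. by rewrite (Ex_law (mx k) (lawx k) m3 mu3). Qed.

Lemma rint_sqr_law k : rint P (fun w => x k w ^+ 2).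
Proof. exact: (rint_law (mx k) (lawx k) m2).1. Qed.

Lemma Ex_sqr_law k : \int[P]_w (x k w ^+ 2) = 1.
Proof. by rewrite -mu2 (Ex_law (mx k) (lawx k) m2 i2). Qed.

Lemma rint_id_law k : rint P (x k).
Proof. exact: rint_of_sqr (rint_sqr_law k). Qed.

Lemma Ex_id_law k : \int[P]_w x k w = 0.
Proof.
have i1 : rint mu id by exact: rint_of_sqr.
by rewrite -mu1 (Ex_law (mx k) (lawx k) _ i1).
Qed.

End moments.

(** Both approximations err on the same side, so the gap is paid once instead of twice. *)
Lemma ler_dist_gap (R : realFieldType) (a a' b b' gap L : R) :
  a <= a' -> a' <= a + gap -> b <= b' -> b' <= b + gap -> `|a' - b'| <= L ->
  `|a - b| <= gap + L.
Proof.
rewrite !ler_norml => h1 h2 h3 h4 /andP[h5 h6].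
by apply/andP; split; lra.
Qed.

Section comparison.
Context {R : realType} {K : choiceType} {S : finType} (s0 : S) (l : seq K)
  (e : S -> K -> R).
Hypotheses (ul : uniq l) (e1 : forall s k, e s k = 1 \/ e s k = -1).
Notation M := (maxlin s0 l e).

Lemma rint_maxlin d (T : measurableType d) (P : probability T R) (x : K -> T -> R) :
  (forall k, rint P (x k)) -> rint P (fun w => M (fun k => x k w)).
Proof.
move=> ix; apply: (@rint_le _ _ _ _ _ (fun w => \sum_(k <- l) `|x k w|)).
- by apply: measurable_maxlin => k; exact: rint_measurable (ix k).
- by move=> w; exact: le_trans (norm_maxlin _ _ e1 _) (ler_norm _).
- by apply: rint_sum => k; exact: rint_norm.
Qed.

Section two_laws.
Context d d' (T : measurableType d) (T' : measurableType d')
  (P : probability T R) (Q : probability T' R) (mu nu : probability R R)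
  (x : K -> {RV P >-> R}) (y : K -> {RV Q >-> R}).
Hypotheses (indx : mutually_independent x) (indy : mutually_independent y)
  (lawx : forall k A, measurable A -> P (x k @^-1` A) = mu A)
  (lawy : forall k A, measurable A -> Q (y k @^-1` A) = nu A)
  (mu3 : rint mu (fun r => `|r| ^+ 3)) (mu1 : \int[mu]_r r = 0)
  (mu2 : \int[mu]_r (r ^+ 2) = 1)
  (nu3 : rint nu (fun r => `|r| ^+ 3)) (nu1 : \int[nu]_r r = 0)
  (nu2 : \int[nu]_r (r ^+ 2) = 1).

Let W := (P \x Q)%E.
Let Z := join_rv x y.

Let indZ : mutually_independent Z. Proof. exact: indep_join. Qed.

Let lawZl k A : measurable A -> W (Z (inl k) @^-1` A) = mu A.
Proof. by move=> mA; rewrite -(lawx k)//; exact: law_join_inl. Qed.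

Let lawZr k A : measurable A -> W (Z (inr k) @^-1` A) = nu A.
Proof. by move=> mA; rewrite -(lawy k)//; exact: law_join_inr. Qed.

Lemma Ex_maxlin_hybrid0 :
  \int[W]_w M (hybrid Z [::] w) = \int[P]_w M (fun k => x k w).
Proof.
have i1 := rint_maxlin (rint_id_law lawx mu3).
rewrite (Ex_law (P := W) (U := fst) _ _ (rint_measurable i1) i1)//.
exact: law_fst.
Qed.

Lemma Ex_maxlin_hybrid1 :
  \int[W]_w M (hybrid Z l w) = \int[Q]_w M (fun k => y k w).
Proof.
have i1 := rint_maxlin (rint_id_law lawy nu3).
rewrite (Ex_law (P := W) (U := snd) _ _ (rint_measurable i1) i1)//.
  apply: eq_Ex => w; apply: maxlin_ext => k kl.
  by rewrite /hybrid kl.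
exact: law_snd.
Qed.

Lemma maxlin_comparison (b : R) : 0 < b ->
  `|\int[P]_w M (fun k => x k w) - \int[Q]_w M (fun k => y k w)| <=
  b^-1 * ln #|S|%:R +
  (size l)%:R * (2 * b ^+ 2 *
    (\int[mu]_r (`|r| ^+ 3) + \int[nu]_r (`|r| ^+ 3))).
Proof.
move=> b0.
have Z3 u : rint W (fun w => `|Z u w| ^+ 3).
  case: u => k; first exact: (rint_cube_law (x := fun k => Z (inl k)) lawZl mu3).
  exact: (rint_cube_law (x := fun k => Z (inr k)) lawZr nu3).
have EZ u : \int[W]_w Z u w = 0.
  case: u => k; first exact: (Ex_id_law (x := fun k => Z (inl k)) lawZl mu3 mu1).
  exact: (Ex_id_law (x := fun k => Z (inr k)) lawZr nu3 nu1).
have EZ2 u : \int[W]_w (Z u w ^+ 2) = 1.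
  case: u => k; first exact: (Ex_sqr_law (x := fun k => Z (inl k)) lawZl mu3 mu2).
  exact: (Ex_sqr_law (x := fun k => Z (inr k)) lawZr nu3 nu2).
have EZ3l k : \int[W]_w (`|Z (inl k) w| ^+ 3) <= \int[mu]_r (`|r| ^+ 3).
  by rewrite (Ex_cube_law (x := fun k => Z (inl k)) lawZl mu3).
have EZ3r k : \int[W]_w (`|Z (inr k) w| ^+ 3) <= \int[nu]_r (`|r| ^+ 3).
  by rewrite (Ex_cube_law (x := fun k => Z (inr k)) lawZr nu3).
pose gap := b^-1 * ln #|S|%:R.
pose G := softmax l e b.
pose q k v := b * (1 - slope l e b k v ^+ 2) / 2.
have ge x' : M x' <= G x' by exact: maxlin_le_softmax.
have le x' : G x' <= M x' + gap by exact: softmax_le_maxlin.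
have growG v : `|G v| <= gap + \sum_(k <- l) `|v k|.
  have := norm_maxlin s0 l e1 v; have := ge v; have := le v.
  rewrite !ler_norml => h1 h2 /andP[h3 h4]; apply/andP; split; lra.
have mG : measurable_functional G by exact: measurable_softmax.
have ms k : measurable_functional (slope l e b k) by exact: measurable_slope.
have mq k : measurable_functional (q k).
  move=> d0 T0 Y0 mY0; have msY := ms k _ _ _ mY0.
  apply: measurable_funM => //; apply: measurable_funM => //.
  by apply: measurable_funB => //; exact: measurable_funX.
have bq k v : `|q k v| <= b / 2.
  have := norm_slope s0 l b e1 k v; rewrite -(ler_pXn2r (n := 2)) ?nnegrE//.
  rewrite expr1n real_normK ?num_real// => h.
  have h0 := sqr_ge0 (slope l e b k v).
  rewrite /q ger0_norm; last by rewrite divr_ge0// mulr_ge0 ?subr_ge0// ltW.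
  by rewrite ler_pM2r ?invr_gt0// ler_piMr ?(ltW b0)// lerBlDr lerDl.
have tG v k r : k \in l -> `|G (upd v k r) - G (upd v k 0)
     - slope l e b k (upd v k 0) * r - q k (upd v k 0) * r ^+ 2|
     <= 2 * b ^+ 2 * `|r| ^+ 3.
  exact: softmax_taylor.
have lind := lindeberg indZ mG
  ms mq growG (norm_slope s0 l b e1) bq
  (mulr_ge0 (ler0n _ 2) (sqr_ge0 b)) tG Z3 EZ EZ2 EZ3l EZ3r ul (fun _ h => h).
have iZ u : rint W (Z u).
  by apply: rint_of_sqr => //; exact: rint_sqr_of_cube (Z3 u).
have iM D : rint W (fun w => M (hybrid Z D w)).
  by apply: (rint_maxlin (x := fun k w => hybrid Z D w k)) => k; exact: rint_hybrid.
have iG D : rint W (fun w => G (hybrid Z D w)).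
  apply: (rint_growth mG growG) => k.
  exact: rint_hybrid.
have h1 D : \int[W]_w M (hybrid Z D w) <= \int[W]_w G (hybrid Z D w).
  exact: le_Ex.
have h2 D : \int[W]_w G (hybrid Z D w) <= \int[W]_w M (hybrid Z D w) + gap.
  rewrite -[X in _ + X](Ex_cst W) -ExD//; last exact: rint_cst.
  by apply: le_Ex => //; apply: rintD => //; exact: rint_cst.
rewrite -Ex_maxlin_hybrid0 -Ex_maxlin_hybrid1.
exact: (ler_dist_gap (h1 [::]) (h2 [::]) (h1 l) (h2 l) lind).
Qed.

End two_laws.

Lemma maxlin_variance d (T : measurableType d) (P : probability T R)
    (mu : probability R R) (x : K -> {RV P >-> R}) :
  mutually_independent x ->
  (forall k A, measurable A -> P (x k @^-1` A) = mu A) ->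
  rint mu (fun r => `|r| ^+ 3) -> \int[mu]_r (r ^+ 2) = 1 ->
  let F w := M (fun k => x k w) in
  rint P (fun w => (F w - \int[P]_w F w) ^+ 2) /\
  \int[P]_w (F w - \int[P]_w F w) ^+ 2 <= 2 * (size l)%:R.
Proof.
move=> indx lawx mu3 mu2 F; set m := \int[P]_w F w.
pose W := (P \x P)%E; pose Z := join_rv x x.
have indZ : mutually_independent Z by exact: indep_join.
have lawZl k A : measurable A -> W (Z (inl k) @^-1` A) = mu A.
  by move=> mA; rewrite -(lawx k)//; exact: law_join_inl.
have lawZr k A : measurable A -> W (Z (inr k) @^-1` A) = mu A.
  by move=> mA; rewrite -(lawx k)//; exact: law_join_inr.
have lawZ k A : measurable A -> W (Z (inl k) @^-1` A) = W (Z (inr k) @^-1` A).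
  by move=> mA; rewrite lawZl// lawZr.
have Z2 u : rint W (fun w => Z u w ^+ 2).
  case: u => k; first exact: (rint_sqr_law (x := fun k => Z (inl k)) lawZl mu3).
  exact: (rint_sqr_law (x := fun k => Z (inr k)) lawZr mu3).
have EZ2 u : \int[W]_w (Z u w ^+ 2) = 1.
  case: u => k; first exact: (Ex_sqr_law (x := fun k => Z (inl k)) lawZl mu3 mu2).
  exact: (Ex_sqr_law (x := fun k => Z (inr k)) lawZr mu3 mu2).
have mM : measurable_functional M by exact: measurable_maxlin.
have := resample indZ mM (norm_maxlin s0 l e1) (fun v k r r' => maxlin_lip s0 ul e1 v r r')
  Z2 EZ2 lawZ ul (fun _ h => h).
have iF : rint P F by exact: rint_maxlin (rint_id_law lawx mu3).
have mF := rint_measurable iF.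
have iF2 : rint P (fun w => F w ^+ 2).
  apply: (rint_growth_sqr mM (norm_maxlin s0 l e1) (x := fun w k => x k w)) => // k.
  exact: (rint_sqr_law lawx mu3).
have -> : \int[W]_w (M (hybrid Z [::] w) ^+ 2) = \int[P]_w (F w ^+ 2).
  rewrite (Ex_law (P := W) (U := fst) _ _ (rint_measurable iF2) iF2)//.
  exact: law_fst.
(* On [l], [hybrid Z [::]] reads only the first component of the product space and [hybrid Z l] only
   the second. *)
have -> : \int[W]_w (M (hybrid Z [::] w) * M (hybrid Z l w)) = m * m.
  rewrite -(Ex_prod iF iF); apply: eq_Ex => w; congr (_ * _).
  by apply: maxlin_ext => k kl; rewrite /hybrid kl.
have E w : (F w - m) ^+ 2 = F w ^+ 2 - 2 * m * F w + m ^+ 2 by ring.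
have i1 : rint P (fun w => F w ^+ 2 - 2 * m * F w) by apply: rintB => //; exact: rintZ.
move=> h; split.
  under [X in rint _ X]eq_fun do rewrite E.
  by apply: rintD => //; exact: rint_cst.
rewrite (eq_Ex _ E) ExD//; last exact: rint_cst.
rewrite ExB//; last exact: rintZ.
rewrite ExZ// Ex_cst -/m; have := le_trans (ler_norm _) h; lra.
Qed.

End comparison.

(** * The ground state energy *)

Section ground_state.
Context {R : realType}.
Implicit Types (x : nat -> nat -> R) (s : nat -> R) (N : nat).

Definition quad N s x := \sum_(i < N) \sum_(j < N) s i * s j * x i j.

Definition entries N : seq (nat * nat) := [seq (i, j) | i <- iota 0 N, j <- iota 0 N].

(* A spin configuration is coded by the bits of its minus signs; out-of-range
   indices get the sign [1]. *)
Definition bit_sign N (t : N.-tuple bool) (i : nat) : R := (-1) ^+ nth false t i.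

Definition bit_coef N (t : N.-tuple bool) (k : nat * nat) : R :=
  bit_sign t k.1 * bit_sign t k.2.

Definition no_bits N : N.-tuple bool := [tuple of nseq N false].

Lemma uniq_entries N : uniq (entries N).
Proof. by apply: allpairs_uniq; rewrite ?iota_uniq// => -[? ?] [? ?]. Qed.

Lemma size_entries N : size (entries N) = (N * N)%N.
Proof. by rewrite size_allpairs size_iota. Qed.

Lemma bit_signP N (t : N.-tuple bool) i : bit_sign t i = -1 \/ bit_sign t i = 1.
Proof. by rewrite /bit_sign; case: nth; [left|right]; rewrite ?expr1 ?expr0. Qed.

Lemma bit_coefP N (t : N.-tuple bool) k : bit_coef t k = 1 \/ bit_coef t k = -1.
Proof.
rewrite /bit_coef; case: (bit_signP t k.1) => ->; case: (bit_signP t k.2) => ->;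
  rewrite ?mulrNN ?mulN1r ?mulrN1 ?mulr1 ?mul1r; by [left|right].
Qed.

Lemma lin_quad N (t : N.-tuple bool) x :
  lin (entries N) (@bit_coef N) t (fun k => x k.1 k.2) = quad N (bit_sign t) x.
Proof.
have iotaE (F : nat -> R) : \sum_(i <- iota 0 N) F i = \sum_(i < N) F i.
  by rewrite -(big_mkord xpredT) /index_iota subn0.
rewrite /lin /entries big_allpairs /quad iotaE.
by apply: eq_bigr => i _; rewrite iotaE.
Qed.

(** Passage from a supremum over real-valued spins to a maximum over a finite type. The coordinates
    are the pairs [(i, j)] and the signs are products of two spins, which is how the results on sign
    forms apply. *)
Lemma SmaxE N x : Smax N x =
  maxlin (no_bits N) (entries N) (@bit_coef N) (fun k => x k.1 k.2).
Proof.
rewrite /Smax; set M := maxlin _ _ _ _; set E := (X in sup X).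
have ubE : ubound E M.
  move=> _ [s ss <-].
  pose t : N.-tuple bool := mktuple (fun i => s i == -1).
  have ts (i : 'I_N) : bit_sign t i = s i.
    rewrite /bit_sign nth_mktuple; case: (ss i) => ->; first by rewrite eqxx expr1.
    by rewrite (_ : (1 == -1) = false) ?expr0//; apply/negP => /eqP; lra.
  have -> : \sum_(i < N) \sum_(j < N) s i * s j * x i j = quad N (bit_sign t) x.
    by apply: eq_bigr => i _; apply: eq_bigr => j _; rewrite !ts.
  by rewrite -lin_quad; exact: le_maxlin.
have [t Mt] := maxlin_attained (no_bits N) (entries N) (@bit_coef N) (fun k => x k.1 k.2).
have EM : E M.
  exists (fun i => bit_sign t i); first by move=> i; exact: bit_signP.
  by rewrite /M Mt lin_quad.
apply/eqP; rewrite eq_le; apply/andP; split; first by apply: ge_sup => //; exists M.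
by apply: ub_le_sup => //; exists M.
Qed.

Lemma Smax_attained N x :
  exists2 s, (forall i, s i = -1 \/ s i = 1) & Smax N x = quad N s x.
Proof.
have [t Mt] := maxlin_attained (no_bits N) (entries N) (@bit_coef N) (fun k => x k.1 k.2).
exists (bit_sign t); first exact: bit_signP.
by rewrite SmaxE Mt lin_quad.
Qed.

Lemma quad_le_Smax N s x : (forall i, s i = -1 \/ s i = 1) -> quad N s x <= Smax N x.
Proof.
move=> ss; pose t : N.-tuple bool := mktuple (fun i => s i == -1).
have ts (i : 'I_N) : bit_sign t i = s i.
  rewrite /bit_sign nth_mktuple; case: (ss i) => ->; first by rewrite eqxx expr1.
  by rewrite (_ : (1 == -1) = false) ?expr0//; apply/negP => /eqP; lra.
have -> : quad N s x = quad N (bit_sign t) x.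
  by apply: eq_bigr => i _; apply: eq_bigr => j _; rewrite !ts.
by rewrite -lin_quad SmaxE; exact: le_maxlin.
Qed.

Lemma Smax0 x : Smax 0 x = 0.
Proof. by have [s _ ->] := Smax_attained 0 x; rewrite /quad big_ord0. Qed.

(* Extending an optimal configuration by the better of the two signs of the new
   spin makes the contribution of the new off-diagonal entries nonnegative. *)
Lemma Smax_succ N x : Smax N x - `|x N N| <= Smax N.+1 x.
Proof.
have [s ss ->] := Smax_attained N x.
pose L := \sum_(i < N) s i * x i N + \sum_(j < N) s j * x N j.
pose eps : R := if 0 <= L then 1 else -1.
pose s' i := if i == N then eps else s i.
have s's (i : 'I_N) : s' i = s i by rewrite /s' ltn_eqF.
have s'N : s' N = eps by rewrite /s' eqxx.
have eps2 : eps * eps = 1 by rewrite /eps; case: ifP => _; rewrite ?mulr1 ?mulrNN ?mulr1.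
have epsL : 0 <= eps * L.
  by rewrite /eps; case: ifPn => [L0|]; rewrite ?mul1r// mulN1r -ltNge oppr_ge0 => /ltW.
have quadE : quad N.+1 s' x = quad N s x + eps * L + x N N.
  rewrite /quad big_ord_recr /=.
  under eq_bigr => i _ do rewrite big_ord_recr /= s'N s's.
  rewrite big_split /= big_ord_recr /= s'N eps2 mul1r /L mulrDr !mulr_sumr.
  rewrite !addrA; congr (_ + _ + _ + _).
  - by apply: eq_bigr => i _; apply: eq_bigr => j _; rewrite s's.
  - by apply: eq_bigr => i _; ring.
  - by apply: eq_bigr => i _; rewrite s's; ring.
apply: (@le_trans _ _ (quad N.+1 s' x)); last first.
  apply: quad_le_Smax => i; rewrite /s' /eps; case: ifP => // _; case: ifP; by [right|left].
rewrite quadE -addrA lerD2l -lerBlDl.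
by have := ler_norm (- x N N); rewrite normrN; lra.
Qed.

Definition corrected N x := Smax N x + \sum_(i < N) `|x i i|.

Lemma corrected_nondecreasing x : nondecreasing_seq (corrected ^~ x).
Proof.
apply/nondecreasing_seqP => N; rewrite /corrected big_ord_recr /=.
by have := Smax_succ N x; lra.
Qed.

Lemma diagonal_nondecreasing x :
  nondecreasing_seq (fun N => \sum_(i < N) `|x i i|).
Proof. by apply/nondecreasing_seqP => N; rewrite big_ord_recr /= lerDl. Qed.

Lemma corrected_ge0 N x : 0 <= corrected N x.
Proof.
apply: le_trans (corrected_nondecreasing x (leq0n N)).
by rewrite /corrected Smax0 big_ord0 addr0.
Qed.

End ground_state.

(** * Almost sure convergence *)

Section quartic_subsequence.
Context {R : realType}.

Lemma powR_quartic (k : nat) : (k ^ 4)%:R `^ (3 / 2) = k%:R ^+ 6 :> R.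
Proof.
rewrite natrX -powR_mulrn// -powRrM -powR_mulrn//; congr (_ `^ _).
by field.
Qed.

Lemma quartic_root_exists (N : nat) : exists k, (k ^ 4 <= N < k.+1 ^ 4)%N.
Proof.
elim: N => [|N [k /andP[kN Nk]]]; first by exists 0%N.
case: (ltnP N.+1 (k.+1 ^ 4)) => h; first by exists k; rewrite h (leqW kN).
by exists k.+1; rewrite h (leq_ltn_trans Nk)// ltn_exp2r.
Qed.

Lemma ratio_cvg1 : (fun k => k.+1%:R / k.+2%:R : R) @ \oo --> (1 : R).
Proof.
have -> : (fun k => k.+1%:R / k.+2%:R : R) = (fun k => 1 - harmonic k.+1).
  apply/funext => k; rewrite /harmonic /=; have : k.+2%:R != 0 :> R by [].
  by rewrite -[k.+2%:R]natr1; move: k.+1%:R => m m0; field.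
rewrite -[X in _ --> X]subr0; apply: cvgB; first exact: cvg_cst.
by rewrite (cvg_shiftS (@harmonic R)); exact: cvg_harmonic.
Qed.

Lemma cvg_quartic (a : nat -> R) (e : R) :
  nondecreasing_seq a -> (forall N, 0 <= a N) ->
  (fun k => a (k.+1 ^ 4)%N / k.+1%:R ^+ 6) @ \oo --> e ->
  (fun N => N%:R `^ (- (3 / 2)) * a N) @ \oo --> e.
Proof.
move=> amono a0 ae.
(* For [k^4 <= N < (k+1)^4], monotonicity of [a] and of the power bracket the normalised [a N]
   between [u k] and [v k]; each differs from the given subsequence by a ratio tending to 1. *)
pose u k : R := a (k ^ 4)%N / k.+1%:R ^+ 6.
pose v k : R := a (k.+1 ^ 4)%N / k%:R ^+ 6.
have q6 : (fun k => (k.+1%:R / k.+2%:R : R) ^+ 6) @ \oo --> (1 : R).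
  rewrite -[X in _ --> X](expr1n _ 6).
  exact: (cvg_comp _ _ ratio_cvg1 (@exprn_continuous R 6 1)).
have ue : u @ \oo --> e.
  rewrite -(cvg_shiftS u); have h := cvgM ae q6; rewrite mulr1 in h.
  have -> : [sequence u n.+1]_n =
      (fun k => a (k.+1 ^ 4)%N / k.+1%:R ^+ 6 * (k.+1%:R / k.+2%:R) ^+ 6).
    by apply/funext => k; rewrite /u/= expr_div_n mulrA divfK// expf_neq0// pnatr_eq0.
  exact: h.
have ve : v @ \oo --> e.
  have ae' : (fun k => a (k.+2 ^ 4)%N / k.+2%:R ^+ 6) @ \oo --> e.
    by rewrite (cvg_shiftS (fun k => a (k.+1 ^ 4)%N / k.+1%:R ^+ 6)).
  rewrite -(cvg_shiftS v); have h := cvgM ae' (cvgV (oner_neq0 _) q6).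
  rewrite divr1 in h.
  have -> : [sequence v n.+1]_n =
      (fun k => (a (k.+2 ^ 4)%N / k.+2%:R ^+ 6) / (k.+1%:R / k.+2%:R) ^+ 6).
    apply/funext => k; rewrite /v/=; have : k.+1%:R != 0 :> R by [].
    have : k.+2%:R != 0 :> R by [].
    by move: k.+1%:R k.+2%:R => m m' m0 m'0; field; rewrite m0 m'0.
  exact: h.
have [r rP] := choice quartic_root_exists.
have rge M N : (M ^ 4 <= N)%N -> (M <= r N)%N.
  move=> MN; rewrite leqNgt; apply/negP => rM.
  have /andP[_] := rP N; rewrite ltnNge => /negP; apply.
  by apply: leq_trans MN; rewrite leq_exp2r.
have roo : r @ \oo --> \oo.
  move=> A [M _ MA]; exists (M ^ 4)%N => // N /= MN.
  by apply: MA => /=; exact: rge.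
suff sq : \forall N \near \oo, u (r N) <= N%:R `^ (- (3 / 2)) * a N <= v (r N).
  have h1 : (fun N => u (r N)) @ \oo --> e by exact: (cvg_comp _ _ roo ue).
  have h2 : (fun N => v (r N)) @ \oo --> e by exact: (cvg_comp _ _ roo ve).
  by apply: (squeeze_cvgr sq h1 h2).
near=> N; have r1 : (0 < r N)%N.
  by apply: rge; rewrite exp1n; near: N; exact: nbhs_infty_ge.
have /andP[rN Nr] := rP N.
have p3 : 0 <= 3 / 2 :> R by lra.
have lo : (r N)%:R ^+ 6 <= N%:R `^ (3 / 2) :> R.
  by rewrite -powR_quartic ge0_ler_powR ?nnegrE// ler_nat.
have hi : N%:R `^ (3 / 2) <= (r N).+1%:R ^+ 6 :> R.
  by rewrite -powR_quartic ge0_ler_powR ?nnegrE// ler_nat ltnW.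
have lo0 : 0 < (r N)%:R ^+ 6 :> R by rewrite exprn_gt0// ltr0n.
have mid0 := lt_le_trans lo0 lo; have hi0 := lt_le_trans mid0 hi.
rewrite /u /v powRN [_^-1 * a N]mulrC; apply/andP; split.
  by apply: (ler_pM _ _ (amono _ _ rN)); rewrite ?invr_ge0 ?(ltW hi0)// lef_pV2.
by apply: (ler_pM _ _ (amono _ _ (ltnW Nr))); rewrite ?invr_ge0 ?(ltW mid0)// lef_pV2.
Unshelve. all: by end_near. Qed.

End quartic_subsequence.

Section almost_sure.
Context d (T : measurableType d) {R : realType} (P : probability T R).

Lemma sum_inv_sqr_le (n : nat) : \sum_(k < n) (k.+1%:R ^- 2) <= 2 :> R.
Proof.
(* The bound is strengthened so that induction goes through: [1 / (m + 1)^2 <= 1 / m - 1 / (m + 1)]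
   telescopes. *)
suff h : \sum_(k < n.+1) (k.+1%:R ^- 2) <= 2 - n.+1%:R^-1 :> R.
  apply: (@le_trans _ _ (\sum_(k < n.+1) (k.+1%:R ^- 2))).
    by rewrite big_ord_recr /= lerDl invr_ge0 exprn_ge0.
  by rewrite (le_trans h)// gerBl invr_ge0.
elim: n => [|n IH]; first by rewrite big_ord1 mulr1n expr1n !invr1; lra.
rewrite big_ord_recr /= (le_trans (lerD IH (lexx _)))//.
have n0 : 0 < n.+1%:R :> R by rewrite ltr0n.
rewrite -[n.+2%:R]natr1; set m : R := n.+1%:R in n0 *.
have m1 : 0 < m + 1 by rewrite addr_gt0.
suff h : (m + 1) ^- 2 <= m^-1 - (m + 1)^-1.
  by rewrite (le_trans (lerD (lexx _) h))// addrA subrK.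
have -> : m^-1 - (m + 1)^-1 = (m * (m + 1))^-1.
  by field; rewrite !gt_eqF.
rewrite lef_pV2 ?posrE ?exprn_gt0 ?mulr_gt0// expr2 ler_pM2r//.
by rewrite lerDl.
Qed.

(** The sum of the [U k] has finite mean by monotone convergence, so it is almost surely finite and
    its terms tend to 0. *)
Lemma ae_cvg0 (U : nat -> T -> R) (C : R) :
  (forall k, rint P (U k)) -> (forall k w, 0 <= U k w) ->
  (forall k, \int[P]_w U k w <= C * k.+1%:R ^- 2) ->
  {ae P, forall w, (fun k => U k w) @ \oo --> (0 : R)}.
Proof.
move=> iU U0 EU.
have C0 : 0 <= C.
  by have := le_trans (Rintegral_ge0 (D := setT) P (fun w _ => U0 0%N w)) (EU 0%N); rewrite expr1n invr1 mulr1.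
pose S w := (\sum_(0 <= k <oo) (U k w)%:E)%E.
have mU k : measurable_fun setT (EFin \o U k).
  by apply/measurable_EFinP; exact: rint_measurable (iU k).
have mS : measurable_fun setT S.
  apply: ge0_emeasurable_sum; first by move=> k w *; rewrite lee_fin.
  by move=> k _; exact: mU.
have S0 w : (0 <= S w)%E by apply: nneseries_ge0 => k _ _; rewrite lee_fin.
have iS : P.-integrable setT S.
  apply/integrableP; split=> //.
  have -> : (\int[P]_w `|S w| = \int[P]_w S w)%E.
    by apply: eq_integral => w _; rewrite gee0_abs.
  rewrite /S integral_nneseries//; last by move=> k w _; rewrite lee_fin.
  apply: (@le_lt_trans _ _ (C * 2)%:E); last exact: ltry.
  apply: lime_le.
    by apply: is_cvg_nneseries => k _ _; apply: integral_ge0 => w _; rewrite lee_fin.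
  apply: nearW => n; rewrite big_mkord.
  apply: (@le_trans _ _ (\sum_(k < n) (C * k.+1%:R ^- 2)%:E)%E).
    apply: lee_sum => k _.
    have := iU k => /(integrable_fin_num measurableT)/fineK <-.
    by rewrite lee_fin; exact: EU.
  rewrite sumEFin lee_fin -mulr_sumr ler_wpM2l//.
  exact: sum_inv_sqr_le.
have := integrable_ae measurableT iS; apply: filterS => w /(_ I) Sw.
apply: cvg_series_cvg_0; apply: nondecreasing_is_cvgn.
  apply/nondecreasing_seqP => n.
  by rewrite /series/= big_nat_recr//= lerDl.
exists (fine (S w)) => _ [n _ <-].
rewrite -lee_fin fineK// /series/= -sumEFin.
by apply: nneseries_lim_ge => k _ _; rewrite lee_fin.
Qed.

End almost_sure.

(** * Concentration along the quartic subsequence *)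

Section iid_entries.
Context d {T : measurableType d} {R : realType} (P : probability T R)
  (mu : probability R R) (xi : nat -> nat -> {RV P >-> R}).
Hypotheses (indxi : mutually_independent (fun k : nat * nat => xi k.1 k.2))
  (lawxi : forall i j A, measurable A -> P (xi i j @^-1` A) = mu A)
  (mu3 : rint mu (fun r => `|r| ^+ 3)) (mu2 : \int[mu]_r (r ^+ 2) = 1).

Let X (k : nat * nat) : {RV P >-> R} := xi k.1 k.2.

Let lawX k A : measurable A -> P (X k @^-1` A) = mu A.
Proof. exact: lawxi. Qed.

Lemma Smax_rvE N w : Smax_rv N xi w =
  maxlin (no_bits N) (entries N) (@bit_coef R N) (fun k => X k w).
Proof. by rewrite /Smax_rv SmaxE. Qed.

Lemma Smax_rv_fun N : Smax_rv N xi =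
  fun w => maxlin (no_bits N) (entries N) (@bit_coef R N) (fun k => X k w).
Proof. by apply/funext => w; exact: Smax_rvE. Qed.

Lemma rint_Smax N : rint P (Smax_rv N xi).
Proof.
rewrite Smax_rv_fun.
by apply: rint_maxlin; [exact: bit_coefP|exact: rint_id_law lawX mu3].
Qed.

Lemma Smax_variance N :
  rint P (fun w => (Smax_rv N xi w - \int[P]_w Smax_rv N xi w) ^+ 2) /\
  \int[P]_w (Smax_rv N xi w - \int[P]_w Smax_rv N xi w) ^+ 2 <= 2 * (N * N)%:R.
Proof.
rewrite Smax_rv_fun -(size_entries N).
exact: (maxlin_variance (no_bits N) (uniq_entries N) (@bit_coefP R N) indxi lawX mu3 mu2).
Qed.

Let quartic (k : nat) : nat := (k.+1 ^ 4)%N.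

Let ae_deviation : {ae P, forall w, (fun k =>
  ((Smax_rv (quartic k) xi w - \int[P]_w Smax_rv (quartic k) xi w) / k.+1%:R ^+ 6) ^+ 2)
  @ \oo --> (0 : R)}.
Proof.
have E k w : ((Smax_rv (quartic k) xi w - \int[P]_w Smax_rv (quartic k) xi w)
     / k.+1%:R ^+ 6) ^+ 2 = (k.+1%:R ^+ 6) ^- 2 *
    (Smax_rv (quartic k) xi w - \int[P]_w Smax_rv (quartic k) xi w) ^+ 2.
  by rewrite expr_div_n mulrC.
apply: (@ae_cvg0 _ _ _ P _ 2) => [k|k w|k].
- have [i _] := Smax_variance (quartic k).
  by under [X in rint _ X]eq_fun do rewrite E; exact: rintZ.
- exact: sqr_ge0.
- have [i v] := Smax_variance (quartic k).
  rewrite (eq_Ex _ (E k)) ExZ//.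
  have k0 : 0 < k.+1%:R :> R by rewrite ltr0n.
  apply: (@le_trans _ _ ((k.+1%:R ^+ 6) ^- 2 * (2 * (quartic k * quartic k)%:R))).
    by rewrite ler_wpM2l// invr_ge0 exprn_ge0// exprn_ge0.
  rewrite /quartic natrM natrX.
  have k1 : 1 <= k.+1%:R :> R by rewrite ler1n.
  move: k.+1%:R k0 k1 => m m0 m1.
  have -> : (m ^+ 6) ^- 2 * (2 * (m ^+ 4 * m ^+ 4)) = 2 * m ^- 4.
    by field; rewrite gt_eqF.
  by rewrite ler_pM2l// lef_pV2 ?posrE ?exprn_gt0// ler_weXn2l.
Qed.

(** First moments suffice: the sum has mean at most [2 (k+1)^4], and dividing by [(k+1)^6] leaves
    exactly the [2 (k+1)^-2] that [ae_cvg0] accepts. *)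
Let ae_diagonal : {ae P, forall w, (fun k =>
  (\sum_(i < quartic k) `|xi i i w|) / k.+1%:R ^+ 6) @ \oo --> (0 : R)}.
Proof.
have i1 i : rint P (fun w => `|xi i i w|).
  exact: (rint_norm (rint_id_law lawX mu3 (i, i))).
apply: (@ae_cvg0 _ _ _ P _ 2) => [k|k w|k].
- under [X in rint _ X]eq_fun do rewrite mulrC.
  by apply: rintZ; exact: rint_sum.
- by rewrite divr_ge0 ?exprn_ge0// sumr_ge0.
- have -> : \int[P]_w ((\sum_(i < quartic k) `|xi i i w|) / k.+1%:R ^+ 6) =
      (k.+1%:R ^+ 6)^-1 * \sum_(i < quartic k) \int[P]_w `|xi i i w|.
    rewrite -Ex_sum// -ExZ; last exact: rint_sum.
    by apply: eq_Ex => w; rewrite mulrC.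
  have k0 : 0 < k.+1%:R :> R by rewrite ltr0n.
  have h i : \int[P]_w `|xi i i w| <= 2.
    have i2 := rint_sqr_law lawX mu3 (i, i).
    apply: (@le_trans _ _ (\int[P]_w (1 + xi i i w ^+ 2))).
      apply: le_Ex => [//||w]; last exact: normr_le_1Dsqr.
      by apply: rintD => //; exact: rint_cst.
    rewrite ExD//; last exact: rint_cst.
    by rewrite Ex_cst (Ex_sqr_law lawX mu3 mu2 (i, i)).
  apply: (@le_trans _ _ ((k.+1%:R ^+ 6)^-1 * \sum_(i < quartic k) 2)).
    by rewrite ler_wpM2l ?invr_ge0 ?exprn_ge0//; apply: ler_sum => i _.
  rewrite sumr_const card_ord -[2 *+ _]mulr_natr /quartic natrX.
  move: k.+1%:R k0 => m m0; rewrite le_eqVlt; apply/orP; left; apply/eqP.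
  by field; rewrite gt_eqF.
Qed.

Lemma ae_Smax (e : R) :
  (fun k => (\int[P]_w Smax_rv (quartic k) xi w) / k.+1%:R ^+ 6) @ \oo --> e ->
  {ae P, forall w, (fun N : nat => N%:R `^ (- (3 / 2)) * Smax_rv N xi w) @ \oo --> e}.
Proof.
move=> me; have h := ae_diagonal; have := ae_deviation.
apply: filterS2 h => w dw vw.
pose x i j := xi i j w.
have vw0 : (fun k => (Smax_rv (quartic k) xi w - \int[P]_w Smax_rv (quartic k) xi w)
    / k.+1%:R ^+ 6) @ \oo --> (0 : R).
  apply/norm_cvg0P.
  have := cvg_comp _ _ vw (@sqrt_continuous R 0); rewrite sqrtr0.
  apply: cvg_trans; apply: near_eq_cvg; apply: nearW => k /=.
  by rewrite sqrtr_sqr.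
have cw : (fun k => corrected (k.+1 ^ 4) x / k.+1%:R ^+ 6) @ \oo --> e.
  have h0 := cvgD (cvgD vw0 me) dw; rewrite add0r addr0 in h0.
  rewrite (_ : (fun k => corrected _ x / _) = (fun k =>
    (Smax_rv (quartic k) xi w - \int[P]_w Smax_rv (quartic k) xi w) / k.+1%:R ^+ 6
    + (\int[P]_w Smax_rv (quartic k) xi w) / k.+1%:R ^+ 6
    + (\sum_(i < quartic k) `|xi i i w|) / k.+1%:R ^+ 6)); first exact: h0.
  by apply/funext => k; rewrite /corrected -!mulrDl subrK.
(* [Smax] is not monotone in [N], but it is the difference of two nonnegative nondecreasing
   sequences, [corrected] and the diagonal sum; the interpolation is applied to each of them. *)
have c1 := cvg_quartic (corrected_nondecreasing x) (fun N => corrected_ge0 N x) cw.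
have d0 N : 0 <= \sum_(i < N) `|x i i| by exact: sumr_ge0.
have c2 := cvg_quartic (diagonal_nondecreasing x) d0 dw.
have h0 := cvgB c1 c2; rewrite subr0 in h0.
rewrite (_ : (fun N : nat => N%:R `^ _ * _) = (fun N : nat =>
  N%:R `^ (- (3 / 2)) * corrected N x - N%:R `^ (- (3 / 2)) * \sum_(i < N) `|x i i|)).
  exact: h0.
by apply/funext => N; rewrite -mulrBr /corrected addrK.
Qed.

End iid_entries.

(** * Universality *)

Section universality.
Context {R : realType} d d' {T : measurableType d} {T' : measurableType d'}
  (P : probability T R) (Q : probability T' R) (mu nu : probability R R)
  (xi : nat -> nat -> {RV P >-> R}) (g : nat -> nat -> {RV Q >-> R}).
Hypotheses (indxi : mutually_independent (fun k : nat * nat => xi k.1 k.2))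
  (lawxi : forall i j A, measurable A -> P (xi i j @^-1` A) = mu A)
  (indg : mutually_independent (fun k : nat * nat => g k.1 k.2))
  (lawg : forall i j A, measurable A -> Q (g i j @^-1` A) = nu A)
  (mu3 : rint mu (fun r => `|r| ^+ 3)) (mu1 : \int[mu]_r r = 0)
  (mu2 : \int[mu]_r (r ^+ 2) = 1)
  (nu3 : rint nu (fun r => `|r| ^+ 3)) (nu1 : \int[nu]_r r = 0)
  (nu2 : \int[nu]_r (r ^+ 2) = 1).

Let A3 := \int[mu]_r (`|r| ^+ 3).
Let B3 := \int[nu]_r (`|r| ^+ 3).

Lemma Smax_comparison N (b : R) : 0 < b ->
  `|\int[P]_w Smax_rv N xi w - \int[Q]_w Smax_rv N g w| <=
  b^-1 * (N%:R * ln 2) + (N * N)%:R * (2 * b ^+ 2 * (A3 + B3)).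
Proof.
move=> b0; rewrite !Smax_rv_fun.
have h := maxlin_comparison (no_bits N) (uniq_entries N) (@bit_coefP R N) indxi indg
  (fun k => lawxi k.1 k.2) (fun k => lawg k.1 k.2) mu3 mu1 mu2 nu3 nu1 nu2 b0.
apply: (le_trans h); rewrite size_entries card_tuple card_bool natrX lnXn//.
by rewrite -[ln 2 *+ N]mulr_natl.
Qed.

(* The error [N / b + N^2 b^2] is balanced at inverse temperature [b = N^(-1/3)]. *)
Lemma Smax_universality N : (0 < N)%N ->
  N%:R `^ (- (3 / 2)) *
    `|\int[P]_w Smax_rv N xi w - \int[Q]_w Smax_rv N g w| <=
  (ln 2 + 2 * (A3 + B3)) * N%:R `^ (- (1 / 6)).
Proof.
move=> N0; have n0 : 0 < N%:R :> R by rewrite ltr0n.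
set n : R := N%:R in n0 *.
have nn0 : n != 0 by rewrite gt_eqF.
have b0 : 0 < n `^ (- (1 / 3)) by exact: powR_gt0.
have p0 : 0 <= n `^ (- (3 / 2)) by exact: powR_ge0.
apply: (le_trans (ler_wpM2l p0 (Smax_comparison N b0))).
(* The two exponents agree: -3/2 + 1/3 + 1 = -1/6 here, and -3/2 + 2 - 2/3 = -1/6 in [e2]. *)
have e1 : n `^ (- (3 / 2)) * ((n `^ (- (1 / 3)))^-1 * n) = n `^ (- (1 / 6)).
  rewrite -powRN -{3}(powRr1 (ltW n0)) -!powRD ?(negbTE nn0) ?implybT//.
  by congr (_ `^ _); field.
have e2 : n `^ (- (3 / 2)) * (n * n * (n `^ (- (1 / 3))) ^+ 2) = n `^ (- (1 / 6)).
  rewrite -{2 3}(powRr1 (ltW n0)) -powR_mulrn ?powR_ge0// -powRrM.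
  rewrite -!powRD ?(negbTE nn0) ?implybT//.
  by congr (_ `^ _); field.
rewrite natrM -/n le_eqVlt; apply/orP; left; apply/eqP.
rewrite mulrDr [RHS]mulrDl; congr (_ + _).
  by rewrite -e1; ring.
by rewrite -e2; ring.
Qed.

Lemma powR_natN6_cvg0 : (fun N : nat => (N%:R : R) `^ (- (1 / 6))) @ \oo --> (0 : R).
Proof.
apply/cvgr0Pnorm_lt => eps eps0; near=> N.
have N0 : 0 < N%:R :> R by rewrite ltr0n; near: N; exact: nbhs_infty_gt.
rewrite ger0_norm ?powR_ge0// powRN invf_plt ?posrE ?powR_gt0//.
have -> : eps^-1 = (eps^-1 ^+ 6) `^ (1 / 6).
  rewrite -powR_mulrn ?invr_ge0 ?(ltW eps0)// -powRrM (_ : 6%:R * (1 / 6) = 1).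
    by rewrite powRr1// invr_ge0 ltW.
  by field.
rewrite gt0_ltr_powR ?nnegrE ?exprn_ge0 ?invr_ge0 ?(ltW eps0) ?(ltW N0)//.
by near: N; exact: nbhs_infty_gtr.
Unshelve. all: by end_near. Qed.

Lemma ground_state_transfer (e : R) :
  (fun N : nat => N%:R `^ (- (3 / 2)) * \int[Q]_w Smax_rv N g w) @ \oo --> e ->
  (fun N : nat => N%:R `^ (- (3 / 2)) * \int[P]_w Smax_rv N xi w) @ \oo --> e.
Proof.
move=> ge; pose C := ln 2 + 2 * (A3 + B3).
pose dl (N : nat) := N%:R `^ (- (3 / 2)) * \int[P]_w Smax_rv N xi w
  - N%:R `^ (- (3 / 2)) * \int[Q]_w Smax_rv N g w.
have dl0 : dl @ \oo --> (0 : R).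
  apply/norm_cvg0P.
  have up : (fun N : nat => C * (N%:R : R) `^ (- (1 / 6))) @ \oo --> (0 : R).
    by rewrite -(mulr0 C); apply: cvgMl_tmp; exact: powR_natN6_cvg0.
  have sq : \forall N \near \oo, 0 <= `|dl N| <= C * (N%:R : R) `^ (- (1 / 6)).
    near=> N; rewrite normr_ge0/= /dl -mulrBr normrM ger0_norm ?powR_ge0//.
    by apply: Smax_universality; near: N; exact: nbhs_infty_gt.
  by apply: (squeeze_cvgr sq _ up); exact: cvg_cst.
have h := cvgD dl0 ge; rewrite add0r in h.
rewrite (_ : (fun N : nat => _) = (fun N => dl N + N%:R `^ (- (3 / 2)) *
  \int[Q]_w Smax_rv N g w)); first exact: h.
by apply/funext => N; rewrite /dl subrK.
Unshelve. all: by end_near. Qed.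

(** The comparison transfers the limit of the averages. The almost sure convergence is then obtained
    from the variance bound for [xi] itself, around that limit. *)
Lemma ground_state_limit_transfer (e : R) :
  ground_state_limit g e -> ground_state_limit xi e.
Proof.
move=> [_ ge].
have iS N : rint P (Smax_rv N xi) by exact: rint_Smax lawxi mu3 N.
have iG N : rint Q (Smax_rv N g) by exact: rint_Smax lawg nu3 N.
have ge' : (fun N : nat => N%:R `^ (- (3 / 2)) * \int[Q]_w Smax_rv N g w) @ \oo --> e.
  move/fine_cvgP : ge => [_]; apply: cvg_trans; apply: near_eq_cvg.
  by apply: nearW => N; rewrite /= rintE.
have xe := ground_state_transfer ge'.
split; last first.
  apply/fine_cvgP; split; first by apply: nearW => N; rewrite rintE.
  apply: cvg_trans xe; apply: near_eq_cvg.
  by apply: nearW => N; rewrite /= rintE.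
apply: (ae_Smax indxi lawxi mu3 mu2).
pose c N : R := N%:R `^ (- (3 / 2)) * \int[P]_w Smax_rv N xi w.
have sub : (fun k => (k.+1 ^ 4)%N) @ \oo --> \oo.
  move=> A [M _ MA]; exists M => // k /= Mk; apply: MA => /=.
  apply: leq_trans Mk (leq_trans (leqnSn k) _).
  by rewrite -[X in (X <= _)%N]expn1 leq_pexp2l.
have h : (fun k => c (k.+1 ^ 4)%N) @ \oo --> e by exact: (cvg_comp _ _ sub xe).
rewrite (_ : (fun k => _ / _) = (fun k => c (k.+1 ^ 4)%N)); first exact: h.
by apply/funext => k; rewrite /c powRN powR_quartic mulrC.
Qed.

End universality.

Unset Implicit Arguments.

Theorem theorem2 (R : realType) :
  exists C : R, 0 < C /\
  forall (d : measure_display) (T : measurableType d) (P : probability T R)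
         (X : {RV P >-> R}) (xi : nat -> nat -> {RV P >-> R})
         (d' : measure_display) (T' : measurableType d') (Q : probability T' R)
         (g : nat -> nat -> {RV Q >-> R}),
    iid_array xi (distribution P X) ->
    ('E_P[X] = 0)%E ->
    ('E_P[fun w => (X w ^+ 2)%R] = 1)%E ->
    ('E_P[fun w => (`|X w| ^+ 3)%R] < +oo)%E ->
    gaussian_array g ->
    (forall e_infty : R,
        ground_state_limit g e_infty -> ground_state_limit xi e_infty) /\
    (forall N : nat, (1 <= N)%N ->
        ((N%:R `^ (- (3 / 2)))%:E * `|'E_P[Smax_rv N xi] - 'E_Q[Smax_rv N g]|
         <= C%:E * (1 + 'E_P[fun w => (`|X w| ^+ 3)%R])
            * (N%:R `^ (- (1 / 6)))%:E)%E).
Proof.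
pose nu : probability R R := std_normal.
pose B3 := \int[nu]_r (`|r| ^+ 3).
have B0 : 0 <= B3 by apply: Rintegral_ge0 => r _; exact: exprn_ge0.
have l0 : 0 <= ln 2 :> R by rewrite ln_ge0// ler1n.
(* With [A3] the third absolute moment of [X], the estimate to absorb is [ln 2 + 2 (A3 + B3)]: the 2
   multiplies [A3], and the rest is covered by the 1 in [1 + A3]. Only the Gaussian moment [B3]
   enters, so the constant is universal. *)
exists (2 + ln 2 + 2 * B3); split; first by rewrite ltr_wpDr ?mulr_ge0// ltr_wpDr.
move=> d T P X xi d' T' Q g [indxi lawxi] EX EX2 EX3 [indg lawg].
pose mu : probability R R := distribution P X.
have mX : measurable_fun setT X by exact: measurable_funPT.
have lX A : measurable A -> P (X @^-1` A) = mu A by [].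
have m3 : measurable_fun setT (fun r : R => `|r| ^+ 3).
  by apply: measurable_funX; exact: normr_measurable.
have X3 : rint P (fun w => `|X w| ^+ 3).
  apply/integrableP; split; first by apply/measurable_EFinP; exact: measurableT_comp m3 mX.
  move: EX3; rewrite unlock; congr (_ < _)%E; apply: eq_integral => w _ /=.
  by rewrite normrX normr_id.
have X2 := rint_sqr_of_cube mX X3; have X1 := rint_of_sqr mX X2.
have mu3 : rint mu (fun r => `|r| ^+ 3) by exact/(rint_law mX lX m3).
have mu2 : \int[mu]_r (r ^+ 2) = 1.
  have i2 : rint mu (fun r => r ^+ 2) by exact: rint_sqr_of_cube mu3.
  rewrite (Ex_law mX lX _ i2)//; move: EX2; rewrite rintE//.
  by move=> /(congr1 fine).
have mu1 : \int[mu]_r r = 0.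
  have i1 : rint mu id by apply/(rint_law mX lX).
  by rewrite (Ex_law mX lX _ i1)//; move: EX; rewrite rintE// => /(congr1 fine).
have lawg' i j A : measurable A -> Q (g i j @^-1` A) = nu A by exact: lawg.
have nu3 : rint nu (fun r => `|r| ^+ 3) by exact: rint_std_normal_cube.
have nu2 : \int[nu]_r (r ^+ 2) = 1 by exact: Ex_std_normal_sqr.
have nu1 : \int[nu]_r r = 0 by exact: Ex_std_normal.
split=> [e|N N0].
  exact: (ground_state_limit_transfer indxi lawxi indg lawg' mu3 mu1 mu2 nu3 nu1 nu2).
have h := Smax_universality indxi lawxi indg lawg' mu3 mu1 mu2 nu3 nu1 nu2 N0.
rewrite !rintE//; [|exact: (rint_Smax lawg' nu3)|exact: (rint_Smax lawxi mu3)].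
rewrite -EFinB /= -EFinD -!EFinM lee_fin (le_trans h)//.
rewrite (Ex_law mX lX m3 mu3) ler_wpM2r ?powR_ge0//.
set A3 := \int[P]_w _; have A0 : 0 <= A3.
  by apply: Rintegral_ge0 => w _; exact: exprn_ge0.
have := mulr_ge0 l0 A0; have := mulr_ge0 B0 A0.
by rewrite -/B3; lra.
Qed.
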